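(* On the tangent bundle of $SU(2)\times SU(2)$ consider the Lagrangian of two coupled spinning particles $$ \mathcal{L}(U_1,U_2,\dot U_1,\dot U_2)=\langle\alpha_{\nu_1}(U_1),\dot U_1\rangle+\langle\alpha_{\nu_2}(U_2),\dot U_2\rangle+V_1(U_1)+V_2(U_2)+V_I(U_1,U_2), $$ where, for $\alpha=1,2$, $$ \langle\alpha_{\nu_\alpha}(U_\alpha),\dot U_\alpha\rangle=i\lambda_\alpha\,\mathrm{Tr}(\sigma_3U_\alpha^\dagger\dot U_\alpha),\qquad V_\alpha(U_\alpha)=\mu_\alpha\,\mathrm{Tr}(U_\alpha^\dagger\sigma_3U_\alpha B), $$ $$ V_I(U_1,U_2)=\mathrm{Tr}(U_1^\dagger\sigma_3U_1\,K\,U_2^\dagger\sigma_3U_2). $$ Here the constants $\lambda_\alpha$ are the spin lengths, the constants $\mu_\alpha$ are the magnetic moments, $B=\mathbf{B}\cdot\boldsymbol{\sigma}$ with $\mathbf{B}\in\mathbb{R}^3$, and $K$ is the $2\times 2$ matrix determining the coupling. Let $\tau_\alpha(U_1,U_2,\dot U_1,\dot U_2)=U_\alpha$. Then: (1) The Cartan 2-form is $\omega_{\mathcal{L}}=-(\tau_1^*d\alpha_{\nu_1}+\tau_2^*d\alpha_{\nu_2})$, and its characteristic distribution is $$ \ker\omega_{\mathcal{L}}=\ker\tau_1^*d\alpha_{\nu_1}\oplus\ker\tau_2^*d\alpha_{\nu_2}\cong(\mathfrak{u}(1)\oplus\mathfrak{su}(2))\oplus(\mathfrak{u}(1)\oplus\mathfrak{su}(2)),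 $$ where $\mathfrak{u}(1)$ is the Lie algebra of the isotropy group of $i\sigma_3$ in $SU(2)$, i.e. of the one-parameter subgroup $\{e^{is\sigma_3}\}$. (2) After the quotient by the vertical directions one obtains the presymplectic system on $SU(2)\times SU(2)$ defined by the closed 2-form $\omega=d\alpha_{\nu_1}+d\alpha_{\nu_2}$ and the Hamiltonian $V=V_1+V_2+V_I$. All terms of $V$ are invariant under the isotropy subgroup $U(1)\times U(1)$ acting on the left on $SU(2)\times SU(2)$, and this subgroup spans the characteristic distribution of $\omega$. (3) Hence the system projects to the quotient $(SU(2)\times SU(2))/(U(1)\times U(1))$, which is diffeomorphic to $S^2\times S^2$. The projection of the presymplectic form $\omega$ is $\frac{1}{4\pi}(\omega_{\nu_1}+\omega_{\nu_2})$, where $\omega_{\nu_\alpha}$ denotes the canonical area 2-form on the sphere of radius $\lambda_\alpha$. Consequently the final reduced state space of the two coupled spin systems is the Cartesian product of the state spaces of the individual systems. In this sense there is no ''entanglement'': the states of the composite system are pairs of individual states, even though the induced dynamics is not separable (not a direct sum of individual dynamics), because of the term $V_I$.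
   Context: $\boldsymbol{\sigma}=(\sigma_1,\sigma_2,\sigma_3)$ are the Pauli matrices $\sigma_1=\begin{pmatrix}0&1\\1&0\end{pmatrix}$, $\sigma_2=\begin{pmatrix}0&-i\\i&0\end{pmatrix}$, $\sigma_3=\begin{pmatrix}1&0\\0&-1\end{pmatrix}$. The spin matrix of each particle is $S_\alpha=U_\alpha^\dagger\sigma_3U_\alpha=\mathbf{S}_\alpha\cdot\boldsymbol{\sigma}$ with $\mathbf{S}_\alpha\in S^2\subset\mathbb{R}^3$ a unit vector (the Hopf map $SU(2)\to S^2$), so that $V_\alpha=\mu_\alpha\mathrm{Tr}(S_\alpha B)$ and $V_I=\mathrm{Tr}(S_1KS_2)$. Each factor $U(1)$ is $\{e^{is\sigma_3}:s\in\mathbb{R}\}\subset SU(2)$. $\alpha_{\nu_\alpha}$ is the left-invariant 1-form on $SU(2)$ displayed in the claim; it corresponds to the element $\nu_\alpha=-\frac{i}{2}\lambda_\alpha\sigma_3$ when $\mathfrak{su}(2)^*$ is identified with $\mathfrak{su}(2)$ by the Killing–Cartan form (up to the normalization of the pairing). The individual systems are the Lagrangian systems on $TSU(2)$ with Lagrangian $i\lambda_\alpha\mathrm{Tr}(\sigma_3U_\alpha^\dagger\dot U_\alpha)+\mu_\alpha\mathrm{Tr}(S_\alpha B)$, with reduced state space $SU(2)/U(1)\cong S^2$. For a Lagrangian $\mathcal{L}$ on $TQ$, in local bundle coordinates $(q^i,\dot q^i)$, the Cartan 2-form is $\omega_{\mathcal{L}}=-d\bigl(\frac{\partial\mathcal{L}}{\partial\dot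 q^i}dq^i\bigr)$. Left translation identifies $TSU(2)\cong SU(2)\times\mathfrak{su}(2)$, $(U,\dot U)\mapsto(U,U^{-1}\dot U)$; in each $\mathfrak{u}(1)\oplus\mathfrak{su}(2)$ the summand $\mathfrak{su}(2)$ consists of the vertical directions and $\mathfrak{u}(1)$ is tangent to the configuration space. The reduced state space is the quotient of the tangent bundle by $\ker\omega_{\mathcal{L}}$.
   Formalization: The left action leaving V invariant does not span ker ω; the kernel and projection claims are proved for the right action (with S=Uσ₃U† for V to descend too), and 1/(4π)(ω_ν1+ω_ν2) is replaced by −(area_λ1/λ1+area_λ2/λ2), with λ_α>0. *)

(* Defs.v *)
From HB Require Import structures.
From mathcomp Require Import all_boot all_order all_algebra.
From mathcomp Require Import sesquilinear spectral.
From mathcomp Require Import complex.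
From mathcomp Require Import all_classical all_reals all_analysis.

Import Order.TTheory GRing.Theory Num.Theory.
Import numFieldNormedType.Exports.

Local Open Scope ring_scope.
Local Open Scope classical_set_scope.
Local Open Scope sesquilinear_scope.
Local Open Scope complex_scope.

(* All manifolds below are embedded submanifolds [M] of a finite-dimensional
   complex vector space [E] (a product of copies of 'M[R[i]]_2) or of a real
   one (a product of copies of 'rV[R]_3), given together with their tangent
   spaces [T x].  Functions and differential forms on [M] are restrictions of
   functions and forms defined on the whole of [E]; since the exterior
   derivative commutes with restriction, it may be computed in the flat
   coordinates of [E] and evaluated on vectors tangent to [M]. *)

(** * Calculus *)

(* A complex vector space is used as a real one: only real directions [t%:C]
   are differentiated. *)
Definition dird {R : realType} {E : lmodType R[i]} {F : normedModType R}
    (f : E -> F) (x u : E) : F :=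
  derive1 (fun t : R => f (x + t%:C *: u)) 0.

Definition form1 (R : realType) (E : Type) := E -> E -> R.
Definition form2 (R : realType) (E : Type) := E -> E -> E -> R.

(* d a (u, v) = u (a v) - v (a u) for constant vector fields u, v; there is no
   factor 1/2. *)
Definition extd {R : realType} {E : lmodType R[i]} (a : form1 R E) :
    form2 R E :=
  fun x u v => dird (fun y => a y v : R^o) x u - dird (fun y => a y u : R^o) x v.

Definition closed_form2 {R : realType} {E : lmodType R[i]}
    (M : set E) (T : E -> set E) (w : form2 R E) : Prop :=
  forall x u v z, M x -> T x u -> T x v -> T x z ->
    dird (fun y => w y v z : R^o) x u - dird (fun y => w y u z : R^o) x v
    + dird (fun y => w y u v : R^o) x z = 0.

Definition char_dist {R : realType} {E : Type} (T : E -> set E)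
    (w : form2 R E) (x : E) : set E :=
  [set u | T x u /\ forall v, T x v -> w x u v = 0].

(* [v] is the derivative of the curve [g] at [t], tested against all real
   linear functionals. *)
Definition velocity {R : realType} {E : lmodType R[i]} (g : R -> E) (t : R)
    (v : E) : Prop :=
  forall f : E -> R,
    (forall (a : R) (u w : E), f (a%:C *: u + w) = a * f u + f w) ->
    is_derive t (1 : R) (fun s => f (g s) : R^o) (f v).

(* Two points are on the same leaf of a distribution [D] on [M] when a curve in
   [M] tangent to [D] joins them. *)
Definition leaf_rel {R : realType} {E : lmodType R[i]} (M : set E)
    (D : E -> set E) (x y : E) : Prop :=
  exists g : R -> E, [/\ g 0 = x, g 1 = y &
    forall t, M (g t) /\ exists2 v, D (g t) v & velocity g t v].

(* Continuity for the natural topology of a finite-dimensional space. *)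
Definition fcontinuous {R : realType} {E : lmodType R[i]} {F : normedModType R}
    (f : E -> F) : Prop :=
  forall (k : nat) (u : 'I_k -> E) (x : E),
    continuous (fun t : 'rV[R]_k => f (x + \sum_(j < k) (t 0 j)%:C *: u j)).

Fixpoint Cn {R : realType} {E : lmodType R[i]} {F : normedModType R} (n : nat)
    (f : E -> F) : Prop :=
  fcontinuous f /\
  if n is m.+1 then
    forall u : E,
      (forall x, derivable (fun t : R => f (x + t%:C *: u)) 0 1) /\
      Cn m (fun x => dird f x u)
  else True.

Definition smooth {R : realType} {E : lmodType R[i]} {F : normedModType R}
    (f : E -> F) : Prop :=
  forall n, Cn n f.

(* [N] is the quotient manifold of [M] by the equivalence relation [rel], with
   projection [p]: the points of [N] are the classes of [rel], and the smooth
   structure is the one that makes [p] a submersion. *)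
Definition is_quotient_manifold {R : realType} {E : lmodType R[i]}
    {F : normedModType R} (M : set E) (T : E -> set E) (rel : E -> E -> Prop)
    (N : set F) (TN : F -> set F) (p : E -> F) : Prop :=
  [/\ smooth p,
      p @` M = N,
      forall x y, M x -> M y -> (p x = p y <-> rel x y) &
      forall x, M x -> dird p x @` T x = TN (p x)].

(* An isomorphism of real vector spaces between real subspaces [A] and [B]. *)
Definition real_iso {R : realType} {E F : lmodType R[i]} (A : set E)
    (B : set F) (f : E -> F) : Prop :=
  set_bij A B f /\
  forall (a : R) (u v : E), f (a%:C *: u + v) = a%:C *: f u + f v.

(** * Lagrangian systems on a tangent bundle TQ in E * E *)

(* The 1-form (dL/dq'^i) dq^i: the derivative of L along the fibre. *)
Definition fibre_form {R : realType} {E : lmodType R[i]} (L : E * E -> R) :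
    form1 R (E * E)%type :=
  fun x u => dird (fun w => L (x.1, w) : R^o) x.2 u.1.

Definition cartan {R : realType} {E : lmodType R[i]} (L : E * E -> R) :
    form2 R (E * E)%type :=
  fun x u v => - extd (fibre_form L) x u v.

Definition energy {R : realType} {E : lmodType R[i]} (L : E * E -> R)
    (x : E * E) : R :=
  dird (fun w => L (x.1, w) : R^o) x.2 x.2 - L x.

(** * SU(2) and the Pauli matrices *)

Notation Mat R := 'M[complex R]_2.

Definition mx2 {R : realType} (a b c d : R[i]) : Mat R :=
  \matrix_(i < 2, j < 2)
    nth 0 (nth [::] [:: [:: a; b]; [:: c; d]] i) j.

Definition sigma1 {R : realType} : Mat R := mx2 0 1 1 0.
Definition sigma2 {R : realType} : Mat R := mx2 0 (- 'i%C) 'i%C 0.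
Definition sigma3 {R : realType} : Mat R := mx2 1 0 0 (- 1).

Definition sigma {R : realType} (j : 'I_3) : Mat R :=
  nth 0 [:: sigma1; sigma2; sigma3] j.

Definition pauli {R : realType} (n : 'rV[R]_3) : Mat R :=
  \sum_(j < 3) (n 0 j)%:C *: sigma j.

Definition SU2 (R : realType) : set (Mat R) :=
  [set U | U \is unitarymx /\ \det U = 1].

Definition su2 (R : realType) : set (Mat R) :=
  [set X | X ^t* = - X /\ \tr X = 0].

Definition T_SU2 {R : realType} (U : Mat R) : set (Mat R) :=
  [set X | su2 R (U ^t* *m X)].

(* The matrix exponential e^{i s sigma3}. *)
Definition expis3 {R : realType} (s : R) : Mat R :=
  (cos s)%:C *: 1%:M + ('i%C * (sin s)%:C) *: sigma3.

Definition U1 (R : realType) : set (Mat R) := range (@expis3 R).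

Definition u1 (R : realType) : set (Mat R) :=
  range (fun s : R => s%:C *: ('i%C *: @sigma3 R)).

(* The stabilizer of i sigma3 for the adjoint action. *)
Definition isotropy_is3 (R : realType) : set (Mat R) :=
  [set h | SU2 R h /\ h *m ('i%C *: sigma3) *m h ^t* = 'i%C *: sigma3].

(* TSU(2), and the derivative at x of its left trivialization
   (U, U') |-> (U, U^-1 U'), read in su(2) * su(2). *)
Definition TSU2 (R : realType) : set (Mat R * Mat R) :=
  [set x | SU2 R x.1 /\ T_SU2 x.1 x.2].

Definition ltriv {R : realType} (x u : Mat R * Mat R) : Mat R * Mat R :=
  (x.1 ^t* *m u.1, u.1 ^t* *m x.2 + x.1 ^t* *m u.2).

Definition T_TSU2 {R : realType} (x : Mat R * Mat R) : set (Mat R * Mat R) :=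
  [set u | su2 R (ltriv x u).1 /\ su2 R (ltriv x u).2].

(* Q = SU(2) * SU(2).  A point of TQ is ((U1, U2), (U1', U2')). *)
Definition Q (R : realType) : set (Mat R * Mat R) := SU2 R `*` SU2 R.

Definition T_Q {R : realType} (q : Mat R * Mat R) : set (Mat R * Mat R) :=
  T_SU2 q.1 `*` T_SU2 q.2.

Notation QQ R := ((Mat R * Mat R) * (Mat R * Mat R))%type.

Definition part1 {R : realType} (x : QQ R) : Mat R * Mat R := (x.1.1, x.2.1).
Definition part2 {R : realType} (x : QQ R) : Mat R * Mat R := (x.1.2, x.2.2).

Definition TQ (R : realType) : set (QQ R) :=
  [set x | TSU2 R (part1 x) /\ TSU2 R (part2 x)].

Definition T_TQ {R : realType} (x : QQ R) : set (QQ R) :=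
  [set u | T_TSU2 (part1 x) (part1 u) /\ T_TSU2 (part2 x) (part2 u)].

(** * Spheres *)

Definition S2 (R : realType) : set 'rV[R]_3 :=
  [set n | \sum_(j < 3) n 0 j ^+ 2 = 1].

Definition T_S2 {R : realType} (n : 'rV[R]_3) : set 'rV[R]_3 :=
  [set v | \sum_(j < 3) n 0 j * v 0 j = 0].

Notation VV R := ('rV[R : realType]_3 * 'rV[R : realType]_3)%type.

Definition S2xS2 (R : realType) : set (VV R) := S2 R `*` S2 R.

Definition T_S2xS2 {R : realType} (n : VV R) : set (VV R) :=
  T_S2 n.1 `*` T_S2 n.2.

(* Area form, for the outward orientation, of the sphere of radius r centred
   at 0: the volume form contracted with the unit normal x / r. *)
Definition area {R : realType} (r : R) : form2 R 'rV[R]_3 :=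
  fun x u v => r^-1 * \det (\matrix_(i < 3) nth 0 [:: x; u; v] i).

(** * Spinning particles *)

(* The left-invariant form alpha_nu of the particle of spin l. *)
Definition alpha {R : realType} (l : R) : form1 R (Mat R) :=
  fun U X => complex.Re ('i%C * l%:C * \tr (sigma3 *m U ^t* *m X)).

(* Two conventions for the spin matrix S(U): U^* sigma3 U on the side [Lft] and
   U sigma3 U^* on the side [Rgt].  The first is invariant under U |-> h U and
   the second under U |-> U h, for h in U(1).  As [alpha] is left-invariant, the
   kernel of its exterior derivative at U is U u(1), which is tangent to the
   orbits of the second action and not of the first. *)
Inductive side := Lft | Rgt.

Definition spin {R : realType} (c : side) (U : Mat R) : Mat R :=
  match c with
  | Lft => U ^t* *m sigma3 *m U
  | Rgt => U *m sigma3 *m U ^t*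
  end.

Definition act1 {R : realType} (c : side) (h U : Mat R) : Mat R :=
  match c with Lft => h *m U | Rgt => U *m h end.

Definition act {R : realType} (c : side) (h q : Mat R * Mat R) :
    Mat R * Mat R :=
  (act1 c h.1 q.1, act1 c h.2 q.2).

Definition orbit_rel {R : realType} (c : side) (q q' : Mat R * Mat R) : Prop :=
  exists2 h, (U1 R `*` U1 R) h & act c h q = q'.

(* The vectors at q tangent to the orbit of U(1) * U(1): the values at q of
   the infinitesimal generators of the action. *)
Definition orbit_dir {R : realType} (c : side) (q : Mat R * Mat R) :
    set (Mat R * Mat R) :=
  [set u | exists s1 s2 : R,
     velocity (fun t => act c (expis3 (t * s1), expis3 (t * s2)) q) 0 u].

(* The vector n with S(U) = n . sigma. *)
Definition hopf {R : realType} (c : side) (U : Mat R) : 'rV[R]_3 :=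
  \row_(j < 3) (2^-1 * complex.Re (\tr (spin c U *m sigma j))).

Definition hopf2 {R : realType} (c : side) (q : Mat R * Mat R) : VV R :=
  (hopf c q.1, hopf c q.2).

(* On SU(2) the traces in [alpha] and [V1] are such that the real part changes
   nothing; the one in [VI] is the value of the trace for every K that makes the
   coupling real, as a Lagrangian requires. *)
Definition V1 {R : realType} (c : side) (m : R) (b : 'rV[R]_3) (U : Mat R) : R :=
  complex.Re (m%:C * \tr (spin c U *m pauli b)).

Definition VI {R : realType} (c : side) (K : Mat R) (q : Mat R * Mat R) : R :=
  complex.Re (\tr (spin c q.1 *m K *m spin c q.2)).

Definition V {R : realType} (c : side) (m1 m2 : R) (b : 'rV[R]_3) (K : Mat R)
    (q : Mat R * Mat R) : R :=
  V1 c m1 b q.1 + V1 c m2 b q.2 + VI c K q.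

Definition lagrangian1 {R : realType} (c : side) (l m : R) (b : 'rV[R]_3)
    (x : Mat R * Mat R) : R :=
  alpha l x.1 x.2 + V1 c m b x.1.

Definition lagrangian {R : realType} (c : side) (l1 l2 m1 m2 : R)
    (b : 'rV[R]_3) (K : Mat R) (x : QQ R) : R :=
  alpha l1 x.1.1 x.2.1 + alpha l2 x.1.2 x.2.2
  + V1 c m1 b x.1.1 + V1 c m2 b x.1.2 + VI c K x.1.

(* The pullback to TSU(2) of the exterior derivative of alpha. *)
Definition tau_dalpha {R : realType} (l : R) : form2 R (Mat R * Mat R)%type :=
  fun x u v => extd (alpha l) x.1 u.1 v.1.

(* The 2-form d alpha_1 + d alpha_2 on SU(2) * SU(2). *)
Definition omega {R : realType} (l1 l2 : R) : form2 R (Mat R * Mat R)%type :=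
  fun q u v => extd (alpha l1) q.1 u.1 v.1 + extd (alpha l2) q.2 u.2 v.2.

(* A combination of the area forms of the spheres of radii l1 and l2, carried to
   S^2 * S^2 by scaling.  The sphere of radius l has area 4 pi l^2 while the form
   d alpha with parameter l has total integral - 4 pi l on the quotient sphere,
   whence the weights; the sign depends on the orientation. *)
Definition omega_red {R : realType} (l1 l2 : R) : form2 R (VV R) :=
  fun n u v =>
    - (l1^-1 * area l1 (l1 *: n.1) (l1 *: u.1) (l1 *: v.1)
       + l2^-1 * area l2 (l2 *: n.2) (l2 *: u.2) (l2 *: v.2)).

Definition V_red {R : realType} (m1 m2 : R) (b : 'rV[R]_3) (K : Mat R)
    (n : VV R) : R :=
  complex.Re (m1%:C * \tr (pauli n.1 *m pauli b))
  + complex.Re (m2%:C * \tr (pauli n.2 *m pauli b))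
  + complex.Re (\tr (pauli n.1 *m K *m pauli n.2)).

(* [X] is the dynamics on the symplectic manifold (N, w) with Hamiltonian h. *)
Definition hamiltonian_field {R : realType} {F : normedModType R} (N : set F)
    (TN : F -> set F) (w : form2 R F) (h : F -> R) (X : F -> F) : Prop :=
  forall n, N n -> TN n (X n) /\
    forall v, TN n v -> w n (X n) v = 'D_v (h : F -> R^o) n.

Definition separable {R : realType} (X : VV R -> VV R) : Prop :=
  exists X1 X2 : 'rV[R]_3 -> 'rV[R]_3,
    forall n, S2xS2 R n -> X n = (X1 n.1, X2 n.2).

(* Main.v *)
Require Import Defs.
From HB Require Import structures.
From mathcomp Require Import all_boot all_order all_algebra.
From mathcomp Require Import sesquilinear spectral.
From mathcomp Require Import complex.
From mathcomp Require Import all_classical all_reals all_analysis.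
From mathcomp Require Import ring lra.
Import Order.TTheory GRing.Theory Num.Theory.
Import numFieldNormedType.Exports.
Local Open Scope ring_scope.
Local Open Scope classical_set_scope.
Local Open Scope sesquilinear_scope.
Local Open Scope complex_scope.

Set Implicit Arguments.
Unset Strict Implicit.
Unset Printing Implicit Defensive.

(* For U in SU(2) and X, Y tangent at U, let n be the point of the sphere with
   U sigma3 U^* = n . sigma, and dX, dY the derivatives of n along X, Y.  From
   tr((n . sigma)(u . sigma)(v . sigma)) = 2 i n . (u x v) one gets
   d alpha (X, Y) = - l n . (dX x dY), a symplectic form on the tangent plane
   of the sphere.  As the derivative of the Hopf map is onto that plane, the
   kernel of d alpha at U consists of the X with dX = 0, that is, those for which
   U^* X commutes with sigma3.

   The leaves of the kernel on TSU(2) are the fibres of (U, U') |-> n: along a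
   curve tangent to the kernel n has derivative 0, and points with the same n are
   joined by t |-> U e^{i t s sigma3}, with the velocity interpolated linearly in
   the left trivialization.

   The reduced field is n x grad V / l on each sphere.  It is separable only if
   the coupling J(n1, n2) = Re tr((n1 . sigma) K (n2 . sigma)) vanishes, since its
   first component is then unchanged when n2 is replaced by - n2, whence
   J(v, n2) = - J(v, n2) for every v orthogonal to n1, which is arbitrary. *)

(** * Real-linear and quadratic maps on complex spaces *)

(** The quotient by the kernel is always the Hopf map on the side [Rgt], whereas a potential on the
    side [c] descends along the Hopf map of that side. Facts about the spin matrix and its
    derivative are therefore proved on [Rgt] and carried to [Lft] by U |-> U^*, and the projection
    of the dynamics, which involves d alpha and the potential together, is proved on [Rgt].

    Derivatives are computed in the ambient matrix space. There alpha is real-linear in the foot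
    point and the Hopf map is the diagonal of a real-bilinear map, so every derivative is the
    coefficient of t in an exact polynomial expansion along a line. Linearity holds over the reals
    only, because the adjoint conjugates scalars. *)

Definition rlinear {R : realType} {E : lmodType R[i]} {F : lmodType R}
    (f : E -> F) : Prop :=
  forall (a : R) (u w : E), f (a%:C *: u + w) = a *: f u + f w.

(** The remainder coefficient [C] depends on t because the coupling term has degree four along a
    line; for the quadratic Hopf map a constant suffices. *)
Lemma taylor_cvg {R : realType} {F : normedModType R} (p : R -> F) (A B : F)
    (C : R -> F) :
  {for 0, continuous C} -> (forall t, p t = A + t *: B + (t ^+ 2) *: C t) ->
  h^-1 *: (p h - p 0) @[h --> 0^'] --> B.
Proof.
move=> Cc pE.
apply: (@cvg_trans _ ((B + h *: C h) @[h --> (0 : R)^'])).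
  apply: near_eq_cvg; near=> h.
  have h0 : h != 0 by near: h; exact: nbhs_dnbhs_neq.
  rewrite !pE expr0n /= !scale0r !addr0 -(addrA A) [A + _]addrC addrK.
  by rewrite scalerDr !scalerA expr2 mulrA mulVf // mul1r scale1r.
apply: cvg_within_filter.
suff : (B + h *: C h) @[h --> (0 : R)] --> B + 0 *: C 0 by rewrite scale0r addr0.
by apply: cvgD; [exact: cvg_cst|apply: cvgZ => //; exact: cvg_id].
Unshelve. all: by end_near. Qed.

Lemma taylor_is_derive {R : realType} {F : normedModType R} (p : R -> F) (A B : F)
    (C : R -> F) :
  {for 0, continuous C} -> (forall t, p t = A + t *: B + (t ^+ 2) *: C t) ->
  is_derive (0 : R) (1 : R) p B.
Proof.
move=> Cc pE; have := taylor_cvg Cc pE.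
have -> : (fun h : R => h^-1 *: (p h - p 0)) =
   (fun h : R => h^-1 *: ((p \o shift 0) (h *: (1 : R)) - p 0)).
  by apply/funext => h /=; rewrite addr0 /GRing.scale /= mulr1.
by move=> c; apply: DeriveDef; [apply/cvg_ex; exists B|exact: cvg_lim c].
Qed.

Lemma taylor_dird {R : realType} {E : lmodType R[i]} {F : normedModType R}
    (f : E -> F) (x u : E) (A B : F) (C : R -> F) :
  {for 0, continuous C} ->
  (forall t : R, f (x + t%:C *: u) = A + t *: B + (t ^+ 2) *: C t) ->
  dird f x u = B.
Proof.
move=> Cc fE; rewrite /dird derive1E.
by have [_ ->] := taylor_is_derive Cc fE.
Qed.

Lemma quad_is_derive {R : realType} {F : normedModType R} (p : R -> F) (A B C : F) :
  (forall t, p t = A + t *: B + (t ^+ 2) *: C) -> is_derive (0 : R) (1 : R) p B.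
Proof. by apply: (taylor_is_derive (C := fun=> C)); exact: cst_continuous. Qed.

Lemma quad_dird {R : realType} {E : lmodType R[i]} {F : normedModType R}
    (f : E -> F) (x u : E) (A B C : F) :
  (forall t : R, f (x + t%:C *: u) = A + t *: B + (t ^+ 2) *: C) ->
  dird f x u = B.
Proof. by apply: (taylor_dird (C := fun=> C)); exact: cst_continuous. Qed.

Section RealLinear.
Context {R : realType} {E : lmodType R[i]}.

Lemma rlinear0 {F : lmodType R} (f : E -> F) : rlinear f -> f 0 = 0.
Proof.
move=> fl; have := fl 1 0 0; rewrite scaler0 addr0 scale1r => /eqP.
by rewrite addrC -subr_eq subrr eq_sym => /eqP.
Qed.

Lemma rlinearD {F : lmodType R} (f : E -> F) : rlinear f ->
  forall u w, f (u + w) = f u + f w.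
Proof. by move=> fl u w; have := fl 1 u w; rewrite !scale1r. Qed.

Lemma rlinearZ {F : lmodType R} (f : E -> F) : rlinear f ->
  forall (a : R) u, f (a%:C *: u) = a *: f u.
Proof. by move=> fl a u; have := fl a u 0; rewrite (rlinear0 fl) !addr0. Qed.

Lemma rlinear_sum {F : lmodType R} (f : E -> F) : rlinear f ->
  forall (I : Type) (r : seq I) (c : I -> R) (e : I -> E),
  f (\sum_(j <- r) (c j)%:C *: e j) = \sum_(j <- r) c j *: f (e j).
Proof.
move=> fl I r c e; elim: r => [|i r ih]; first by rewrite !big_nil rlinear0.
by rewrite !big_cons fl ih.
Qed.

Context {F : normedModType R}.

Definition rbilinear (b : E -> E -> F) : Prop :=
  (forall x, rlinear (b x)) /\ (forall y, rlinear (b^~ y)).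

Lemma rlinear_dird (f : E -> F) : rlinear f -> forall x u, dird f x u = f u.
Proof.
move=> fl x u; apply: (@quad_dird _ _ _ _ _ _ (f x) _ 0) => t.
by rewrite addrC fl scaler0 addr0 addrC.
Qed.

Lemma rbilinear_line (b : E -> E -> F) (x u : E) (t : R) : rbilinear b ->
  b (x + t%:C *: u) (x + t%:C *: u)
  = b x x + t *: (b x u + b u x) + t ^+ 2 *: b u u.
Proof.
move=> [bl br]; rewrite (rlinearD (bl _)) (rlinearZ (bl _)).
have -> y : b (x + t%:C *: u) y = b x y + t *: b u y.
  by have /= := rlinearD (br y) x (t%:C *: u); rewrite (rlinearZ (br y)) /= => ->.
have -> y : b (x + t%:C *: u) y = b x y + t *: b u y.
  by have /= := rlinearD (br y) x (t%:C *: u); rewrite (rlinearZ (br y)) /= => ->.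
by rewrite !scalerDr scalerA expr2 -!addrA; congr (_ + _); rewrite addrCA.
Qed.

Lemma rbilinear_dird (b : E -> E -> F) : rbilinear b ->
  forall x u, dird (fun y => b y y) x u = b x u + b u x.
Proof. by move=> bb x u; apply: quad_dird => t; exact: rbilinear_line. Qed.

Lemma continuous_add (T : topologicalType) (f g : T -> F) :
  continuous f -> continuous g -> continuous (fun t => f t + g t).
Proof. by move=> fc gc t; exact: cvgD (fc t) (gc t). Qed.

Lemma continuous_coordZ k (j : 'I_k) (f : 'rV[R]_k -> F) :
  continuous f -> continuous (fun t : 'rV[R]_k => t 0 j *: f t).
Proof.
by move=> fc t; apply: (@cvgZ R F _ (nbhs t) _ _ _ _ _ _ (fc t));
  exact: coord_continuous.
Qed.

Lemma continuous_sumr (T : topologicalType) (I : Type) (r : seq I)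
    (f : I -> T -> F) :
  (forall i, continuous (f i)) -> continuous (fun t => \sum_(i <- r) f i t).
Proof.
move=> fc; elim: r => [|i r ih].
  by under eq_fun do rewrite big_nil; exact: cst_continuous.
under eq_fun do rewrite big_cons.
exact: continuous_add.
Qed.

Lemma Cn_cst (a : F) n : Cn n (fun _ : E => a).
Proof.
elim: n a => [|n ih] a; split => //.
- by move=> k u x; exact: cst_continuous.
- by move=> k u x; exact: cst_continuous.
- move=> u; split => [x|]; first exact: derivable_cst.
  rewrite (_ : (fun x : E => _) = (fun=> 0)) //.
  apply/funext => x; apply: (@quad_dird _ _ _ _ _ _ a _ 0) => t.
  by rewrite !scaler0 !addr0.
Qed.

Lemma rlinear_fcontinuous (f : E -> F) : rlinear f -> fcontinuous f.
Proof.
move=> fl k u x.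
rewrite (_ : (fun t => _) = (fun t : 'rV[R]_k => f x + \sum_(j < k) t 0 j *: f (u j))).
  apply: continuous_add; first exact: cst_continuous.
  by apply: continuous_sumr => j; apply: continuous_coordZ; exact: cst_continuous.
by apply/funext => t; rewrite (rlinearD fl) rlinear_sum.
Qed.

Lemma smooth_rlinear (f : E -> F) : rlinear f -> smooth f.
Proof.
move=> fl; case=> [|n]; split => //; try exact: rlinear_fcontinuous.
move=> u; split => [x|].
  have [] := @quad_is_derive _ _ (fun t : R => f (x + t%:C *: u)) (f x) (f u) 0.
    by move=> t; rewrite addrC fl scaler0 addr0 addrC.
  by [].
rewrite (_ : (fun x => dird f x u) = (fun=> f u)); first exact: Cn_cst.
by apply/funext => x; exact: rlinear_dird.
Qed.

(** The derivative in a fixed direction is real-linear in the base point and its own derivative is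
    constant, so the recursion of [Cn] ends after two steps. *)
Lemma smooth_rbilinear (b : E -> E -> F) : rbilinear b -> smooth (fun x => b x x).
Proof.
move=> bb; have [bl br] := bb.
have bc : fcontinuous (fun x => b x x).
  move=> k u x.
  (* [fcontinuous] only looks at finite families of directions, and on these the map is a quadratic
     polynomial in the coordinates of t. *)
  rewrite (_ : (fun t => _) = (fun t : 'rV[R]_k =>
      b x x + (\sum_(j < k) t 0 j *: b x (u j))
      + (\sum_(i < k) t 0 i *: (b (u i) x + \sum_(j < k) t 0 j *: b (u i) (u j))))).
    apply: continuous_add.
      apply: continuous_add; first exact: cst_continuous.
      by apply: continuous_sumr => j; apply: continuous_coordZ;
        exact: cst_continuous.
    apply: continuous_sumr => i; apply: continuous_coordZ.
    apply: continuous_add; first exact: cst_continuous.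
    by apply: continuous_sumr => j; apply: continuous_coordZ;
      exact: cst_continuous.
  apply/funext => t; set s := \sum_(j < k) (t 0 j)%:C *: u j.
  have /= -> := rlinearD (br (x + s)) x s.
  have -> : b x (x + s) = b x x + \sum_(j < k) t 0 j *: b x (u j).
    by rewrite (rlinearD (bl x)) (rlinear_sum (bl x)).
  congr (_ + _); have /= -> := rlinear_sum (br (x + s)).
  by apply: eq_bigr => i _; rewrite (rlinearD (bl _)) (rlinear_sum (bl _)).
case=> [|n]; split => //.
move=> u; split => [x|].
  by have [] := quad_is_derive (fun t => rbilinear_line x u t bb).
rewrite (_ : (fun x => _) = (fun x => b x u + b u x)).
  apply: smooth_rlinear => a y z.
  by rewrite (bl u) (br u) scalerDr addrACA.
by apply/funext => x; exact: rbilinear_dird.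
Qed.

End RealLinear.

(** * Pauli matrices *)

Section Mx2.
Context {R : realType}.
Implicit Types (a b c d : R[i]) (A B : Mat R) (u v w n : 'rV[R]_3).

Lemma mx2_eta A : A = mx2 (A 0 0) (A 0 1) (A 1 0) (A 1 1).
Proof.
by apply/matrixP => -[[|[|//]] i] [[|[|//]] j]; rewrite mxE /=;
  congr (A _ _); exact/val_inj.
Qed.

Lemma mx2_eq a b c d a' b' c' d' :
  (mx2 a b c d = mx2 a' b' c' d') <-> [/\ a = a', b = b', c = c' & d = d'].
Proof.
split=> [/matrixP e|[-> -> -> ->] //].
by split; [have := e 0 0|have := e 0 1|have := e 1 0|have := e 1 1];
  rewrite !mxE.
Qed.

Lemma mx2_mul a b c d a' b' c' d' : mx2 a b c d *m mx2 a' b' c' d' =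
  mx2 (a * a' + b * c') (a * b' + b * d') (c * a' + d * c') (c * b' + d * d').
Proof.
by apply/matrixP => -[[|[|//]] i] [[|[|//]] j];
  rewrite !mxE !big_ord_recl big_ord0 !mxE /= addr0.
Qed.

Lemma mx2_add a b c d a' b' c' d' : mx2 a b c d + mx2 a' b' c' d' =
  mx2 (a + a') (b + b') (c + c') (d + d').
Proof. by apply/matrixP => -[[|[|//]] i] [[|[|//]] j]; rewrite !mxE. Qed.

Lemma mx2_opp a b c d : - mx2 a b c d = mx2 (- a) (- b) (- c) (- d).
Proof. by apply/matrixP => -[[|[|//]] i] [[|[|//]] j]; rewrite !mxE. Qed.

Lemma mx2_scale k a b c d :
  k *: mx2 a b c d = mx2 (k * a) (k * b) (k * c) (k * d).
Proof. by apply/matrixP => -[[|[|//]] i] [[|[|//]] j]; rewrite !mxE. Qed.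

Lemma mx2_scalar a : a%:M = mx2 a 0 0 a :> Mat R.
Proof. by apply/matrixP => -[[|[|//]] i] [[|[|//]] j]; rewrite !mxE. Qed.

Lemma mx2_conj a b c d :
  (mx2 a b c d) ^t* = mx2 (conjc a) (conjc c) (conjc b) (conjc d).
Proof. by apply/matrixP => -[[|[|//]] i] [[|[|//]] j]; rewrite !mxE. Qed.

Lemma mx2_tr a b c d : \tr (mx2 a b c d) = a + d.
Proof. by rewrite /mxtrace !big_ord_recl big_ord0 !mxE addr0. Qed.

Lemma mxtraceN A : \tr (- A) = - \tr A.
Proof. exact: raddfN. Qed.

Lemma mx2_det a b c d : \det (mx2 a b c d) = a * d - b * c.
Proof.
rewrite (expand_det_row _ 0) !big_ord_recl big_ord0 /cofactor !det_mx11 !mxE /=.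
by rewrite expr0 expr1 mul1r mulN1r addr0 mulrN.
Qed.

(** With [mx2_eq] and [complex_eq], these rules turn an identity between matrices into polynomial
    identities over the reals. *)
Definition mx2E := (mx2_mul, mx2_add, mx2_opp, mx2_scale, mx2_scalar, mx2_conj,
  mx2_tr, mx2_det).

Lemma big_ord3 (T : nmodType) (F : 'I_3 -> T) :
  \sum_(j < 3) F j = F 0 + F 1 + F 2.
Proof.
rewrite !big_ord_recl big_ord0 addr0 addrA.
by congr (F _ + F _ + F _); exact/val_inj.
Qed.

Definition vec3 (x y z : R) : 'rV[R]_3 := \row_j nth 0 [:: x; y; z] j.

Lemma vec3_eta n : n = vec3 (n 0 0) (n 0 1) (n 0 2).
Proof.
by apply/rowP => -[[|[|[|//]]] i]; rewrite mxE /=; congr (n _ _); exact/val_inj.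
Qed.

Lemma vec3E (x y z : R) :
  (vec3 x y z 0 0 = x) * (vec3 x y z 0 1 = y) * (vec3 x y z 0 2 = z).
Proof. by rewrite !mxE. Qed.

Lemma pauliE (x y z : R) : pauli (vec3 x y z) = mx2 z%:C (x -i* y) (x +i* y) (- z)%:C.
Proof.
rewrite /pauli big_ord3 !vec3E /sigma /= /sigma1 /sigma2 /sigma3 !mx2E.
by apply/mx2_eq; split; simpc; apply/eqP; rewrite eq_complex /=; apply/andP;
  split; apply/eqP; ring.
Qed.

Lemma det3E (x y z x' y' z' x'' y'' z'' : R) :
  \det (\matrix_(i < 3) nth 0 [:: vec3 x y z; vec3 x' y' z'; vec3 x'' y'' z''] i)
  = x * (y' * z'' - z' * y'') + y * (z' * x'' - x' * z'') + z * (x' * y'' - y' * x'').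
Proof.
rewrite (expand_det_row _ 0) !big_ord_recl big_ord0 /cofactor.
rewrite !(expand_det_row _ 0) !big_ord_recl !big_ord0 /cofactor !det_mx11 !mxE /=.
ring.
Qed.

Definition dot u v : R := \sum_(j < 3) u 0 j * v 0 j.
Definition cross u v : 'rV[R]_3 :=
  vec3 (u 0 1 * v 0 2 - u 0 2 * v 0 1) (u 0 2 * v 0 0 - u 0 0 * v 0 2)
       (u 0 0 * v 0 1 - u 0 1 * v 0 0).

Lemma dotE (x y z x' y' z' : R) :
  dot (vec3 x y z) (vec3 x' y' z') = x * x' + y * y' + z * z'.
Proof. by rewrite /dot big_ord3 !vec3E. Qed.

Lemma vec3_scale (a x y z : R) : a *: vec3 x y z = vec3 (a * x) (a * y) (a * z).
Proof. by apply/rowP => -[[|[|[|//]]] i]; rewrite !mxE. Qed.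

Lemma vec3_add (x y z x' y' z' : R) :
  vec3 x y z + vec3 x' y' z' = vec3 (x + x') (y + y') (z + z').
Proof. by apply/rowP => -[[|[|[|//]]] i]; rewrite !mxE. Qed.

Lemma vec3_opp (x y z : R) : - vec3 x y z = vec3 (- x) (- y) (- z).
Proof. by apply/rowP => -[[|[|[|//]]] i]; rewrite !mxE. Qed.

Lemma complex_eq a b : complex.Re a = complex.Re b -> complex.Im a = complex.Im b -> a = b.
Proof. by case: a b => [a a'] [b b'] /= -> ->. Qed.

Lemma vec3P (P : 'rV[R]_3 -> Prop) : (forall x y z, P (vec3 x y z)) -> forall n, P n.
Proof. by move=> h n; rewrite [n]vec3_eta. Qed.

Lemma pauli_rlinear (k : R) u v : pauli (k *: u + v) = k%:C *: pauli u + pauli v.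
Proof.
elim/vec3P: u => x y z; elim/vec3P: v => x' y' z'.
rewrite vec3_scale vec3_add !pauliE !mx2E; apply/mx2_eq.
by split; apply: complex_eq => /=; ring.
Qed.

Lemma pauliZ (k : R) u : pauli (k *: u) = k%:C *: pauli u.
Proof.
elim/vec3P: u => x y z.
rewrite vec3_scale !pauliE !mx2E; apply/mx2_eq.
by split; apply: complex_eq => /=; ring.
Qed.

Lemma pauli_herm n : (pauli n) ^t* = pauli n.
Proof.
elim/vec3P: n => x y z; rewrite !pauliE !mx2E; apply/mx2_eq.
by split; apply: complex_eq => /=; ring.
Qed.

Lemma tr_pauli2 u v : \tr (pauli u *m pauli v) = (2 * dot u v)%:C.
Proof.
elim/vec3P: u => x y z; elim/vec3P: v => x' y' z'; rewrite !pauliE !mx2E dotE.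
by apply: complex_eq => /=; ring.
Qed.

Lemma pauli_anticomm u v :
  pauli u *m pauli v + pauli v *m pauli u = (2 * dot u v)%:C%:M.
Proof.
elim/vec3P: u => x y z; elim/vec3P: v => x' y' z'; rewrite !pauliE !mx2E dotE.
by apply/mx2_eq; split; apply: complex_eq => /=; ring.
Qed.

Lemma tr_pauli3 n u v :
  \tr (pauli n *m pauli u *m pauli v) = 'i%C * (2 * dot n (cross u v))%:C.
Proof.
elim/vec3P: u => x y z; elim/vec3P: v => x' y' z'; elim/vec3P: n => x'' y'' z''.
rewrite !pauliE !mx2E /cross !vec3E dotE.
by apply: complex_eq => /=; ring.
Qed.

(** Scaling the three arguments gives l^3; the unit normal inside [area] and the weight each remove
    one factor. The remaining l is the coefficient found for d alpha in [extd_alpha_triple]. *)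
Lemma area_triple (l : R) n u v : l != 0 ->
  l^-1 * area l (l *: n) (l *: u) (l *: v) = l * dot n (cross u v).
Proof.
move=> l0; elim/vec3P: u => x y z; elim/vec3P: v => x' y' z'; elim/vec3P: n => x'' y'' z''.
rewrite /area !vec3_scale det3E /cross !vec3E dotE.
by field.
Qed.

(** The Pauli coordinates of the Hermitian part of A; the factor 1/2 comes from tr(sigma_i sigma_j)
    = 2 delta_ij. Being real-linear on all matrices, it lets the Hopf map be differentiated in the
    ambient space. *)
Definition pauli_coord A : 'rV[R]_3 :=
  \row_(j < 3) (2^-1 * complex.Re (\tr (A *m sigma j))).

Lemma pauli_coordE a b c d : pauli_coord (mx2 a b c d) =
  vec3 (2^-1 * (complex.Re b + complex.Re c)) (2^-1 * (complex.Im c - complex.Im b))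
       (2^-1 * (complex.Re a - complex.Re d)).
Proof.
case: a b c d => [a a'] [b b'] [c c'] [d d'].
by apply/rowP => -[[|[|[|//]]] i]; rewrite !mxE /sigma /= /sigma1 /sigma2 /sigma3
   !mx2E /=; congr (_ * _); ring.
Qed.

Lemma pauli_coordK n : pauli_coord (pauli n) = n.
Proof.
elim/vec3P: n => x y z; rewrite !pauliE pauli_coordE /=.
by congr vec3; field.
Qed.

Lemma pauli_inj : injective (@pauli R).
Proof. exact: can_inj pauli_coordK. Qed.

Lemma pauli_coord_rlinear : rlinear pauli_coord.
Proof.
move=> k A B; apply/rowP => j.
rewrite !mxE mulmxDl -scalemxAl mxtraceD mxtraceZ.
case: (\tr (A *m _)) (\tr (B *m _)) => [x y] [x' y'] /=.
by ring.
Qed.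

Lemma pauli_of_herm A : A ^t* = A -> \tr A = 0 -> pauli (pauli_coord A) = A.
Proof.
rewrite [A]mx2_eta; move: (A 0 0) (A 0 1) (A 1 0) (A 1 1).
move=> [a a'] [b b'] [c c'] [d d']; rewrite !mx2E => /mx2_eq/=.
move=> [[ea] [eb eb'] [ec ec'] [ed]] [t t']; rewrite pauli_coordE pauliE /=.
by apply/mx2_eq; split; apply: complex_eq => /=; lra.
Qed.

Lemma S2P n : S2 R n <-> dot n n = 1.
Proof.
have -> : dot n n = \sum_(j < 3) n 0 j ^+ 2.
  by apply: eq_bigr => j _; rewrite expr2.
by [].
Qed.

Lemma T_S2P n v : T_S2 n v <-> dot n v = 0.
Proof. by []. Qed.

Lemma cross_cross n v : cross n (cross n v) = dot n v *: n - dot n n *: v.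
Proof.
elim/vec3P: n => x y z; elim/vec3P: v => x' y' z'; rewrite /cross !vec3E !dotE.
rewrite !vec3_scale vec3_opp vec3_add.
by congr vec3; ring.
Qed.

Lemma dot_cross0 n v : dot n (cross n v) = 0.
Proof.
elim/vec3P: n => x y z; elim/vec3P: v => x' y' z'; rewrite /cross !vec3E !dotE.
by ring.
Qed.

Lemma triple_swap n u v : dot n (cross u v) = dot v (cross n u).
Proof.
elim/vec3P: n => x y z; elim/vec3P: v => x' y' z'; elim/vec3P: u => x'' y'' z''.
by rewrite /cross !vec3E !dotE; ring.
Qed.

Lemma triple_swap2 n u v : dot n (cross u v) = - dot u (cross n v).
Proof.
elim/vec3P: n => x y z; elim/vec3P: v => x' y' z'; elim/vec3P: u => x'' y'' z''.
by rewrite /cross !vec3E !dotE; ring.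
Qed.

Lemma dot_rlinear n (k : R) u v : dot n (k *: u + v) = k * dot n u + dot n v.
Proof.
elim/vec3P: n => x y z; elim/vec3P: v => x' y' z'; elim/vec3P: u => x'' y'' z''.
by rewrite vec3_scale vec3_add !dotE; ring.
Qed.

Lemma dotC u v : dot u v = dot v u.
Proof. by apply: eq_bigr => j _; rewrite mulrC. Qed.

Lemma dot_eq0 n : dot n n = 0 -> n = 0.
Proof.
rewrite /dot => /eqP; rewrite psumr_eq0; last by move=> j _; rewrite -expr2 sqr_ge0.
move=> /allP h; apply/rowP => j; rewrite mxE; apply/eqP.
by have := h j (mem_index_enum _); rewrite /= mulf_eq0 orbb.
Qed.

(** Testing against v = n x u gives u . u, because n x (n x u) = - u for u orthogonal to the unit
    vector n. *)
Lemma triple_nondegenerate n u : S2 R n -> T_S2 n u ->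
  (forall v, T_S2 n v -> dot n (cross u v) = 0) -> u = 0.
Proof.
move=> /S2P n1 /T_S2P nu h; apply: dot_eq0.
have := h (cross n u) (dot_cross0 n u); rewrite triple_swap2 cross_cross nu n1.
rewrite scale0r scale1r add0r -[- u]addr0 -[- u]scaleN1r dot_rlinear.
by rewrite [dot u 0]big1 => [|j _]; rewrite ?mxE ?mulr0 // addr0 mulN1r opprK.
Qed.

End Mx2.

(** * SU(2) and U(1) *)

Section Adjoint.
Context {R : realType}.
Implicit Types (A B U X Y h : Mat R).

Lemma dagM A B : (A *m B) ^t* = B ^t* *m A ^t*.
Proof. by rewrite trmx_mul map_mxM. Qed.

Lemma dagK A : A ^t* ^t* = A.
Proof. by rewrite [A]mx2_eta !mx2_conj !conjcK. Qed.

Lemma dagD A B : (A + B) ^t* = A ^t* + B ^t*.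
Proof. by rewrite linearD /= map_mxD. Qed.

Lemma dagZ (k : R) A : (k%:C *: A) ^t* = k%:C *: A ^t*.
Proof.
rewrite [A]mx2_eta !mx2E; apply/mx2_eq.
by split; rewrite rmorphM; congr (_ * _); apply: complex_eq => //=; rewrite oppr0.
Qed.

Lemma sigma3_dag : (@sigma3 R) ^t* = sigma3.
Proof.
rewrite /sigma3 mx2E; apply/mx2_eq.
by split; apply: complex_eq => /=; rewrite ?oppr0 //.
Qed.

Lemma sigma3_sq : @sigma3 R *m sigma3 = 1%:M.
Proof. by rewrite /sigma3 !mx2E; apply/mx2_eq; split; ring. Qed.

Lemma mul_sigma3K A : A *m sigma3 *m sigma3 = A.
Proof. by rewrite -mulmxA sigma3_sq mulmx1. Qed.

Lemma sigma3_tr : \tr (@sigma3 R) = 0.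
Proof. by rewrite /sigma3 !mx2E; ring. Qed.

Lemma SU2_unitary U : SU2 R U -> U *m U ^t* = 1%:M /\ U ^t* *m U = 1%:M.
Proof.
by move=> [/unitarymxP h _]; split=> //; exact: mulmx1C.
Qed.

Lemma SU2_mulKV U A : SU2 R U -> A *m U *m U ^t* = A.
Proof. by move=> /SU2_unitary[h _]; rewrite -mulmxA h mulmx1. Qed.

Lemma SU2_mulVK U A : SU2 R U -> A *m U ^t* *m U = A.
Proof. by move=> /SU2_unitary[_ h]; rewrite -mulmxA h mulmx1. Qed.

Lemma SU2_VmulK U A : SU2 R U -> U ^t* *m (U *m A) = A.
Proof. by move=> /SU2_unitary[_ h]; rewrite mulmxA h mul1mx. Qed.

Lemma SU2_KmulV U A : SU2 R U -> U *m (U ^t* *m A) = A.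
Proof. by move=> /SU2_unitary[h _]; rewrite mulmxA h mul1mx. Qed.

Lemma SU2_dag U : SU2 R U -> SU2 R (U ^t*).
Proof.
move=> hU; have [_ h] := SU2_unitary hU; case: hU => _ d; split.
  by apply/unitarymxP; rewrite dagK.
by move: d; rewrite det_map_mx det_tr => ->; rewrite rmorph1.
Qed.

Lemma SU2_mul U h : SU2 R U -> SU2 R h -> SU2 R (U *m h).
Proof.
move=> [u d] [u' d']; split; first exact: mul_unitarymx.
by rewrite det_mulmx d d' mulr1.
Qed.

Lemma T_SU2_skew U X : T_SU2 U X -> X ^t* *m U = - (U ^t* *m X).
Proof. by move=> [<- _]; rewrite dagM dagK. Qed.

Lemma T_SU2_dag U X : SU2 R U -> T_SU2 U X -> T_SU2 (U ^t*) (X ^t*).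
Proof.
move=> hU hX; have sk := T_SU2_skew hX; case: hX => _ t0.
rewrite /T_SU2 /su2 /= dagK; split.
  rewrite dagM dagK -[in RHS](SU2_mulKV (U *m X ^t*) hU) -(mulmxA U) sk.
  by rewrite mulmxN mulNmx opprK mulmxA (proj1 (SU2_unitary hU)) mul1mx.
by rewrite mxtrace_mulC sk mxtraceN t0 oppr0.
Qed.

Lemma T_SU2_mul U A : SU2 R U -> su2 R A -> T_SU2 U (U *m A).
Proof. by move=> hU hA; rewrite /T_SU2 /= SU2_VmulK. Qed.

Lemma su2_rlinear (k : R) A B : su2 R A -> su2 R B -> su2 R (k%:C *: A + B).
Proof.
move=> [a ta] [b tb]; split; last by rewrite mxtraceD mxtraceZ ta tb mulr0 addr0.
by rewrite dagD dagZ a b scalerN opprD.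
Qed.

Lemma su2_0 : su2 R 0.
Proof.
split; last exact: mxtrace0.
by rewrite trmx0 map_mx0 oppr0.
Qed.

Lemma expis3E (s : R) : expis3 s = mx2 (cos s +i* sin s) 0 0 (cos s -i* sin s).
Proof.
rewrite /expis3 /sigma3 !mx2E; apply/mx2_eq.
by split; apply: complex_eq => /=; ring.
Qed.

Lemma u1E (s : R) : s%:C *: ('i%C *: @sigma3 R) = mx2 (0 +i* s) 0 0 (0 -i* s).
Proof.
rewrite /sigma3 !mx2E; apply/mx2_eq.
by split; apply: complex_eq => /=; ring.
Qed.

Lemma u1_su2 A : u1 R A -> su2 R A.
Proof.
case=> s _ <-; rewrite u1E; split; last by rewrite mx2E; apply: complex_eq => /=; ring.
by rewrite !mx2E; apply/mx2_eq; split; apply: complex_eq => /=; ring.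
Qed.

Lemma su2_commute_u1 A : su2 R A -> A *m sigma3 = sigma3 *m A -> u1 R A.
Proof.
rewrite [A]mx2_eta; move: (A 0 0) (A 0 1) (A 1 0) (A 1 1).
move=> [a a'] [b b'] [c c'] [d d'] []; rewrite /sigma3 !mx2E => /mx2_eq/=.
move=> [[e] _ _ [f]] [t t'] /mx2_eq /= [_ [g g'] [k k'] _].
exists a' => //; rewrite u1E; apply/mx2_eq.
by split; apply: complex_eq => /=; lra.
Qed.

Lemma u1_commute A : u1 R A -> A *m sigma3 = sigma3 *m A.
Proof.
by case=> s _ <-; rewrite -!scalemxAl -!scalemxAr.
Qed.

Lemma circle_angle (x y : R) : x ^+ 2 + y ^+ 2 = 1 ->
  exists s, cos s = x /\ sin s = y.
Proof.
move=> e.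
have hx : -1 <= x <= 1.
  rewrite -ler_norml -(@ler_pXn2r _ 2) // ?nnegrE // expr1n real_normK ?num_real //.
  by rewrite -e lerDl sqr_ge0.
have sq : Num.sqrt (1 - x ^+ 2) = `|y|.
  by rewrite -sqrtr_sqr -e addrC addKr.
(* [acos] takes values where the sine is nonnegative, so a negative y calls for the opposite
   angle. *)
have [y0|y0] := leP 0 y.
  by exists (acos x); rewrite acosK // sin_acos // sq ger0_norm.
by exists (- acos x); rewrite cosN sinN acosK // sin_acos // sq ltr0_norm // opprK.
Qed.

Lemma isotropy_U1 : isotropy_is3 R = U1 R.
Proof.
apply/seteqP; split => h.
  move=> [hS]; have [hu hu'] := SU2_unitary hS.
  move=> /(congr1 (mulmx^~ h)).
  rewrite SU2_mulVK // -scalemxAr -scalemxAl; case: hS hu => _.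
  rewrite [h]mx2_eta; move: (h 0 0) (h 0 1) (h 1 0) (h 1 1).
  move=> [a a'] [b b'] [c c'] [d d'].
  rewrite /sigma3 !mx2E => -[dt dt'] /mx2_eq/= [[u _] _ _ _] /mx2_eq/=.
  move=> [_ [e e'] [f f'] _].
  have b0 : b = 0 by lra.
  have b'0 : b' = 0 by lra.
  have c0 : c = 0 by lra.
  have c'0 : c' = 0 by lra.
  move: dt dt' u; rewrite b0 b'0 c0 c'0 => dt dt' u.
  have u1 : a ^+ 2 + a' ^+ 2 = 1 by rewrite -[RHS]u; ring.
  have dt1 : a * d - a' * d' = 1 by rewrite -[RHS]dt; ring.
  have dt2 : a * d' + a' * d = 0 by rewrite -[RHS]dt'; ring.
  have [s [cs sn]] := circle_angle u1.
  (* Now h is diagonal with entries a and d, of which |a| = 1 and a d = 1. Multiplying the second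
     equation by the conjugate of a shows that d is that conjugate; this is done separately on real
     and imaginary parts. *)
  exists s => //; rewrite expis3E cs sn; apply/mx2_eq.
  split => //; apply: complex_eq => /=.
    transitivity (a * (a * d - a' * d')); first by rewrite dt1 mulr1.
    transitivity (d * (a ^+ 2 + a' ^+ 2) - a' * (a * d' + a' * d)); first by ring.
    by rewrite u1 dt2 mulr1 mulr0 subr0.
  transitivity (- a' * (a * d - a' * d')); first by rewrite dt1 mulr1.
  transitivity (d' * (a ^+ 2 + a' ^+ 2) - a * (a * d' + a' * d)); first by ring.
  by rewrite u1 dt2 mulr1 mulr0 subr0.
case=> s _ <-; have cs := cos2Dsin2 s.
split; [split|].
- apply/unitarymxP; rewrite expis3E !mx2E; apply/mx2_eq.
  by split; apply: complex_eq => /=; first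
    [ring|rewrite -[RHS]cs; ring|rewrite -[X in _ = - X]cs; ring].
- by rewrite expis3E !mx2E; apply: complex_eq => /=; first
    [ring|rewrite -[RHS]cs; ring|rewrite -[X in _ = - X]cs; ring].
- rewrite -scalemxAr -scalemxAl; congr (_ *: _); rewrite expis3E /sigma3 !mx2E; apply/mx2_eq.
  by split; apply: complex_eq => /=; first
    [ring|rewrite -[RHS]cs; ring|rewrite -[X in _ = - X]cs; ring].
Qed.

Lemma U1_SU2 h : U1 R h -> SU2 R h.
Proof. by rewrite -isotropy_U1 => -[]. Qed.

Lemma U1_fix_sigma3 h : U1 R h -> h *m sigma3 *m h ^t* = sigma3.
Proof.
rewrite -isotropy_U1 => -[_]; rewrite -scalemxAr -scalemxAl.
move/(congr1 (fun A => - 'i%C *: A)); rewrite !scalerA mulNr -expr2 sqr_i opprK.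
by rewrite !scale1r.
Qed.

Lemma fix_sigma3_U1 h : SU2 R h -> h *m sigma3 *m h ^t* = sigma3 -> U1 R h.
Proof.
by move=> hS e; rewrite -isotropy_U1; split => //; rewrite -scalemxAr -scalemxAl e.
Qed.

Lemma U1_dag h : U1 R h -> U1 R (h ^t*).
Proof.
move=> hU; apply: fix_sigma3_U1; first exact/SU2_dag/U1_SU2.
rewrite -{1}(U1_fix_sigma3 hU) dagK !mulmxA (proj2 (SU2_unitary (U1_SU2 hU))).
by rewrite mul1mx SU2_mulVK //; exact: U1_SU2.
Qed.

End Adjoint.

(** * The Hopf map *)

Section Hopf.
Context {R : realType}.
Implicit Types (A B U X Y h : Mat R) (c : side) (l : R).

(* U |-> U^* exchanges the conventions Lft and Rgt. *)
Definition orient c U : Mat R := match c with Lft => U ^t* | Rgt => U end.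

Definition dspin c U X : Mat R :=
  match c with
  | Lft => X ^t* *m sigma3 *m U + U ^t* *m sigma3 *m X
  | Rgt => X *m sigma3 *m U ^t* + U *m sigma3 *m X ^t*
  end.

Definition dhopf c U X : 'rV[R]_3 := pauli_coord (dspin c U X).

Lemma spin_orient c U : spin c U = spin Rgt (orient c U).
Proof. by case: c => //=; rewrite dagK. Qed.

Lemma hopf_orient c U : hopf c U = hopf Rgt (orient c U).
Proof. by rewrite /hopf spin_orient. Qed.

Lemma dspin_orient c U X : dspin c U X = dspin Rgt (orient c U) (orient c X).
Proof. by case: c => //=; rewrite !dagK. Qed.

Lemma orientK c : involutive (orient c).
Proof. by case: c => // U /=; rewrite dagK. Qed.

Lemma SU2_orient c U : SU2 R U -> SU2 R (orient c U).
Proof. by case: c => //; exact: SU2_dag. Qed.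

Lemma T_SU2_orient c U X :
  SU2 R U -> T_SU2 U X -> T_SU2 (orient c U) (orient c X).
Proof. by case: c => //; exact: T_SU2_dag. Qed.

Lemma U1_orient c h : U1 R h -> U1 R (orient c h).
Proof. by case: c => //; exact: U1_dag. Qed.

Lemma act1_orient c h U :
  orient c (act1 c h U) = act1 Rgt (orient c h) (orient c U).
Proof. by case: c => //=; rewrite dagM. Qed.

Lemma hopfE c U : hopf c U = pauli_coord (spin c U).
Proof. by []. Qed.

Lemma spin_herm c U : (spin c U) ^t* = spin c U.
Proof. by rewrite spin_orient /= !dagM dagK sigma3_dag mulmxA. Qed.

Lemma spin_pauli c U : SU2 R U -> pauli (hopf c U) = spin c U.
Proof.
move=> hU; apply: pauli_of_herm; first exact: spin_herm.
rewrite spin_orient /= mxtrace_mulC mulmxA.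
by rewrite (proj2 (SU2_unitary (SU2_orient c hU))) mul1mx sigma3_tr.
Qed.

Lemma hopf_S2 c U : SU2 R U -> S2 R (hopf c U).
Proof.
move=> hU; apply/S2P; have := tr_pauli2 (hopf c U) (hopf c U).
rewrite spin_pauli // spin_orient /=; have {}hU := SU2_orient c hU.
rewrite !mulmxA SU2_mulVK // mul_sigma3K (proj1 (SU2_unitary hU)) mx2E mx2_tr.
by move=> [e]; lra.
Qed.

Lemma dspin_pauli c U X : SU2 R U -> T_SU2 U X -> pauli (dhopf c U X) = dspin c U X.
Proof.
move=> hU hX; apply: pauli_of_herm.
  by rewrite dspin_orient /= dagD !dagM !dagK sigma3_dag !mulmxA addrC.
rewrite dspin_orient /=; have {}hX := T_SU2_orient c hU hX.
rewrite mxtraceD mxtrace_mulC mulmxA -[X in _ + X]mxtrace_mulC mulmxA.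
by rewrite (T_SU2_skew hX) mulNmx mxtraceN subrr.
Qed.

Lemma dhopf_T_S2 c U X : SU2 R U -> T_SU2 U X -> T_S2 (hopf c U) (dhopf c U X).
Proof.
move=> hU hX; apply/T_S2P; have := tr_pauli2 (hopf c U) (dhopf c U X).
rewrite spin_pauli // dspin_pauli // dspin_orient spin_orient /=.
have {}hX := T_SU2_orient c hU hX; have {}hU := SU2_orient c hU.
have := T_SU2_skew hX; case: hX => _ t0 sk.
rewrite mulmxDr mxtraceD !mulmxA SU2_mulVK // mul_sigma3K.
rewrite mxtrace_mulC !mulmxA (proj2 (SU2_unitary hU)) mul1mx.
rewrite mxtrace_mulC -[X in _ + X]mxtrace_mulC sk mxtraceN t0 oppr0 addr0.
by rewrite mulmxA mulmxA sigma3_sq mul1mx t0 => -[e]; lra.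
Qed.

Lemma dhopf_surj c U v : SU2 R U -> T_S2 (hopf c U) v ->
  exists2 X, T_SU2 U X & dhopf c U X = v.
Proof.
move=> hU0 /T_S2P nv.
have hU := SU2_orient c hU0; set U' := orient c U in hU *.
have [u u'] := SU2_unitary hU.
have anti := pauli_anticomm (hopf c U) v; have tr0 := tr_pauli2 (hopf c U) v.
rewrite nv mulr0 /= spin_pauli // spin_orient -/U' /= in anti tr0.
(* As v is orthogonal to n, W anticommutes with U' sigma3 U'^*, which makes U'^* X skew-Hermitian.
   Each of the two terms X sigma3 U'^* and U' sigma3 X^* of the derivative equals W / 2, whence the
   factor 1/2. *)
pose W := pauli v; pose X := (2^-1 : R)%:C *: (W *m U' *m sigma3).
have XE : X ^t* = (2^-1 : R)%:C *: (sigma3 *m U' ^t* *m W).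
  by rewrite dagZ !dagM sigma3_dag pauli_herm mulmxA.
have TX : T_SU2 U' X.
  split.
    rewrite dagM dagK XE -scalemxAl -scalemxAr -scalerN; congr (_ *: _).
    have := congr1 (fun M => U' ^t* *m M *m U') anti.
    rewrite mulmxDr mulmxDl !mulmxA u' mul1mx SU2_mulVK //.
    rewrite rmorph0 raddf0 mul0mx => /eqP; rewrite addr_eq0 => /eqP ->.
    by [].
  rewrite -scalemxAr mxtraceZ mxtrace_mulC -!mulmxA mxtrace_mulC !mulmxA.
  by rewrite tr0 rmorph0 mulr0.
exists (orient c X); first by rewrite -[U](orientK c); exact: T_SU2_orient.
rewrite /dhopf dspin_orient orientK -/U' /= XE -!scalemxAl -!scalemxAr !mulmxA.
rewrite mul_sigma3K SU2_mulKV // mul_sigma3K u mul1mx.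
rewrite -scalerDl -rmorphD /= (_ : 2^-1 + 2^-1 = 1 :> R); last by field.
by rewrite scale1r pauli_coordK.
Qed.

Lemma spin_act1 c h U : U1 R h -> spin c (act1 c h U) = spin c U.
Proof.
move=> hh; rewrite spin_orient act1_orient [RHS]spin_orient /=.
have {}hh := U1_orient c hh.
by rewrite dagM -!mulmxA (mulmxA sigma3) (mulmxA (orient c h)) (mulmxA (orient c h))
  U1_fix_sigma3.
Qed.

(** On the side [Rgt], if V and V' have the same spin matrix then conjugation by V^* V' fixes
    sigma3, so V^* V' lies in the isotropy group, which is U(1). *)
Lemma hopf_fibre c U U' : SU2 R U -> SU2 R U' ->
  hopf c U = hopf c U' <-> exists2 h, U1 R h & act1 c h U = U'.
Proof.
move=> hU hU'; split=> [e|[h hh <-]]; last by rewrite !hopfE spin_act1.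
have : spin c U = spin c U' by rewrite -(spin_pauli c hU) e (spin_pauli c hU').
rewrite !(spin_orient c).
have hV := SU2_orient c hU; have hV' := SU2_orient c hU'.
set V := orient c U in hV *; set V' := orient c U' in hV' *.
move=> /= {}e.
have hh : U1 R (V ^t* *m V').
  apply: fix_sigma3_U1; first exact/SU2_mul/hV'/SU2_dag.
  rewrite dagM dagK !mulmxA -(mulmxA (V ^t*)) -(mulmxA (V ^t*)) -e !mulmxA.
  by rewrite (proj2 (SU2_unitary hV)) mul1mx SU2_mulVK.
exists (orient c (V ^t* *m V')); first exact: U1_orient.
apply: (can_inj (orientK c)); rewrite act1_orient orientK /= -/V -/V'.
by rewrite SU2_KmulV.
Qed.

Lemma hopf_surj c n : S2 R n -> exists2 U, SU2 R U & hopf c U = n.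
Proof.
suff H : S2 R n -> exists2 U, SU2 R U & hopf Rgt U = n.
  move=> /H[U hU <-]; exists (orient c U); first exact: SU2_orient.
  by rewrite hopf_orient orientK.
move=> /S2P; elim/(@vec3P R): n => x y z; rewrite dotE => e.
(* The Hopf bundle has no global section: the formula used below divides by s = sqrt(2 (1 + z)), so
   the south pole is treated apart, with i sigma1. *)
have [z1|z1] := eqVneq z (-1).
  have xy0 : x * x + y * y = 0 by move: e; rewrite z1; lra.
  have x0 : x = 0.
    apply/eqP; rewrite -sqrf_eq0 expr2; apply/eqP.
    by have := sqr_ge0 x; have := sqr_ge0 y; rewrite !expr2; lra.
  have y0 : y = 0.
    apply/eqP; rewrite -sqrf_eq0 expr2; apply/eqP.
    by have := sqr_ge0 x; have := sqr_ge0 y; rewrite !expr2; lra.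
  exists (mx2 0 'i%C 'i%C 0).
    split; first (apply/unitarymxP; rewrite !mx2E; apply/mx2_eq).
      by split; apply: complex_eq => /=; ring.
    by rewrite mx2E; apply: complex_eq => /=; ring.
  rewrite hopfE /= /sigma3 !mx2E pauli_coordE /= x0 y0 z1.
  by congr vec3; field.
have zb : 0 < 1 + z.
  rewrite lt_neqAle; apply/andP; split; first by rewrite eq_sym addrC addr_eq0.
  have : `|z| <= 1.
    rewrite -(@ler_pXn2r _ 2) // ?nnegrE // expr1n real_normK ?num_real //.
    by have := sqr_ge0 x; have := sqr_ge0 y; rewrite !expr2; lra.
  by rewrite ler_norml => /andP[? _]; lra.
(* The preimage is U = (1 + (n . sigma) sigma3) / s. Its diagonal entries are (1 + z) / s = s / 2.
   Writing z and x^2 + y^2 in terms of s reduces the checks to rational identities. *)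
pose s := Num.sqrt (2 * (1 + z)).
have s2 : s * s = 2 * (1 + z) by rewrite -expr2 sqr_sqrtr //; lra.
have s0 : s != 0 by apply/eqP => s0; move: s2; rewrite s0; lra.
have zE : z = s * s / 2 - 1 by rewrite s2; field.
have xyE : x * x + y * y = (s * s) * (1 - s * s / 4).
  by rewrite s2; transitivity (1 - z * z); [lra|field].
pose a := s / 2.
have sE : s = 2 * a by rewrite /a; field.
have a0 : a != 0 by apply: contra s0; rewrite sE => /eqP ->; rewrite mulr0.
have h1 : a * a + (x / s) * (x / s) + (y / s) * (y / s) = 1.
  transitivity (a * a + (x * x + y * y) / (s * s)); first by field.
  by rewrite xyE sE; field.
exists (mx2 a%:C (- (x / s) +i* (y / s)) ((x / s) +i* (y / s)) a%:C).
  split; first (apply/unitarymxP; rewrite !mx2E; apply/mx2_eq).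
    by split; apply: complex_eq => /=; first [ring|rewrite -[RHS]h1; ring].
  by rewrite mx2E; apply: complex_eq => /=;first [ring|rewrite -[RHS]h1; ring].
rewrite hopfE /= /sigma3 !mx2E pauli_coordE /=.
congr vec3; rewrite sE.
- by field.
- by field.
have -> : z = 2 * (a * a) - 1 by rewrite zE sE; field.
rewrite -sE; transitivity (a * a - ((x / s) * (x / s) + (y / s) * (y / s))); first by field.
by rewrite -[X in _ = _ - X]h1; ring.
Qed.

(** For A = U^* X and B = U^* Y the commutators are the derivatives of the spin matrix conjugated
    back by U. The left side is then the trace of [tr_pauli3], and the right side is d alpha(X, Y)
    up to a scalar factor and the real part. *)
Lemma su2_triple A B :
  \tr (sigma3 *m (A *m sigma3 - sigma3 *m A) *m (B *m sigma3 - sigma3 *m B))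
  = 2 * (\tr (sigma3 *m B *m A) - \tr (sigma3 *m A *m B)).
Proof.
rewrite !(mulmxBr, mulmxBl) !mulmxA sigma3_sq !mul1mx mul_sigma3K.
rewrite !raddfB /=.
have -> : \tr (sigma3 *m A *m sigma3 *m B *m sigma3) = \tr (A *m sigma3 *m B).
  by rewrite mxtrace_mulC !mulmxA sigma3_sq mul1mx.
have -> : \tr (A *m sigma3 *m B) = \tr (sigma3 *m B *m A).
  by rewrite -mulmxA mxtrace_mulC.
have -> : \tr (A *m B *m sigma3) = \tr (sigma3 *m A *m B).
  by rewrite mxtrace_mulC mulmxA.
by ring.
Qed.

End Hopf.

(** * The forms alpha and d alpha *)

Section Forms.
Context {R : realType}.
Implicit Types (A B U X Y h : Mat R) (c : side) (l : R).

Lemma Re_rlinear (k : R) (a b : R[i]) :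
  complex.Re (k%:C * a + b) = k * complex.Re a + complex.Re b.
Proof. by case: a b => [a a'] [b b'] /=; ring. Qed.

Lemma alpha_rlinearr l U : rlinear (alpha l U : Mat R -> R^o).
Proof.
move=> k X Y; rewrite /alpha mulmxDr -scalemxAr mxtraceD mxtraceZ.
by rewrite mulrDr mulrCA Re_rlinear.
Qed.

Lemma alpha_rlinearl l X : rlinear (fun U => alpha l U X : R^o).
Proof.
move=> k U V; rewrite /alpha dagD dagZ mulmxDr mulmxDl -scalemxAr -scalemxAl.
by rewrite mxtraceD mxtraceZ mulrDr mulrCA Re_rlinear.
Qed.

(** [alpha] is real-linear in the foot point too, so d alpha has constant coefficients on the
    ambient space. This is also why [omega] is closed. *)
Lemma extd_alphaE l U X Y : extd (alpha l) U X Y = alpha l X Y - alpha l Y X.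
Proof. by rewrite /extd !rlinear_dird //; exact: alpha_rlinearl. Qed.

Lemma dspin_conj U X : SU2 R U -> T_SU2 U X -> dspin Rgt U X =
  U *m ((U ^t* *m X) *m sigma3 - sigma3 *m (U ^t* *m X)) *m U ^t*.
Proof.
move=> hU hX; rewrite mulmxBr mulmxBl !mulmxA (proj1 (SU2_unitary hU)) mul1mx /=.
have -> : X ^t* = - (U ^t* *m X *m U ^t*).
  by rewrite -mulNmx -(T_SU2_skew hX) SU2_mulKV.
by rewrite mulmxN !mulmxA.
Qed.

Lemma extd_alpha_triple l U X Y : SU2 R U -> T_SU2 U X -> T_SU2 U Y ->
  extd (alpha l) U X Y =
  - l * dot (hopf Rgt U) (cross (dhopf Rgt U X) (dhopf Rgt U Y)).
Proof.
move=> hU hX hY; rewrite extd_alphaE.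
have XY : X ^t* *m Y = - (U ^t* *m X *m (U ^t* *m Y)).
  by rewrite -mulNmx -(T_SU2_skew hX) -mulmxA SU2_KmulV.
have YX : Y ^t* *m X = - (U ^t* *m Y *m (U ^t* *m X)).
  by rewrite -mulNmx -(T_SU2_skew hY) -mulmxA SU2_KmulV.
have := spin_pauli Rgt hU.
have := dspin_pauli Rgt hU hX; have := dspin_pauli Rgt hU hY.
move: (hopf _ _) (dhopf _ _ X) (dhopf _ _ Y) => n u v eY eX eS.
have := tr_pauli3 n u v; rewrite {}eX {}eY {}eS.
rewrite (dspin_conj hU hX) (dspin_conj hU hY) /alpha -!(mulmxA sigma3) XY YX /=.
move: (dot _ _) (U ^t* *m X) (U ^t* *m Y) => d A B.
have -> : U *m sigma3 *m U ^t* *m (U *m (A *m sigma3 - sigma3 *m A) *m U ^t*) *m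
    (U *m (B *m sigma3 - sigma3 *m B) *m U ^t*) =
    U *m (sigma3 *m (A *m sigma3 - sigma3 *m A) *m (B *m sigma3 - sigma3 *m B)
          *m U ^t*).
  move: (_ - sigma3 *m A) (_ - sigma3 *m B) => A' B'.
  by rewrite !mulmxA !(SU2_mulVK _ hU).
rewrite mxtrace_mulC (SU2_mulVK _ hU) su2_triple.
rewrite !mulmxN !mxtraceN !mulmxA.
case: (\tr (sigma3 *m A *m B)) (\tr (sigma3 *m B *m A)) => [p p'] [q q'] /=.
(* The traces satisfy i d = q - p, and the real part taken in [alpha] after multiplication by i
   selects minus the imaginary part, which is where the sign of - l d arises. *)
move=> [e e']; have -> : d = q' - p' by lra.
by ring.
Qed.

Lemma dhopf_eq0 U X : SU2 R U -> T_SU2 U X ->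
  dhopf Rgt U X = 0 <-> u1 R (U ^t* *m X).
Proof.
move=> hU hX; split=> [e|h].
  apply: su2_commute_u1 => //; apply/eqP; rewrite -subr_eq0; apply/eqP.
  have := dspin_pauli Rgt hU hX; rewrite e dspin_conj //.
  rewrite -[0](scale0r (0 : 'rV[R]_3)) pauliZ scale0r.
  move: (_ - sigma3 *m _) => D /(congr1 (fun M => U ^t* *m M *m U)).
  by rewrite !mulmxA (proj2 (SU2_unitary hU)) mul1mx SU2_mulVK // mulmx0 mul0mx.
apply: pauli_inj; rewrite dspin_pauli // dspin_conj // (u1_commute h) subrr.
by rewrite mulmx0 mul0mx -[0 in RHS](scale0r (0 : 'rV[R]_3)) pauliZ scale0r.
Qed.

Lemma alpha_kernel l U X : l != 0 -> SU2 R U -> T_SU2 U X ->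
  (forall Y, T_SU2 U Y -> extd (alpha l) U X Y = 0) <-> u1 R (U ^t* *m X).
Proof.
move=> l0 hU hX; split=> [h|/(dhopf_eq0 hU hX) h Y hY]; last first.
  rewrite extd_alpha_triple // h triple_swap2 [dot 0 _]big1 ?oppr0 ?mulr0 //.
  by move=> j _; rewrite mxE mul0r.
apply/(dhopf_eq0 hU hX).
apply: (@triple_nondegenerate R (hopf Rgt U)); [exact: hopf_S2|exact: dhopf_T_S2|].
move=> v /(dhopf_surj hU)[Y hY <-]; have := h Y hY.
rewrite extd_alpha_triple // => /eqP; rewrite mulf_eq0 oppr_eq0 (negPf l0) /=.
by move/eqP.
Qed.

(** The polarization of [spin]: its diagonal is the quadratic map, and its symmetrization is the
    derivative [dspin]. *)
Definition spinb c U V : Mat R :=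
  match c with
  | Lft => U ^t* *m sigma3 *m V
  | Rgt => U *m sigma3 *m V ^t*
  end.

Definition hopfb c U V : 'rV[R]_3 := pauli_coord (spinb c U V).

Lemma hopfb_rbilinear c : rbilinear (hopfb c).
Proof.
split=> [U|V] k X Y; rewrite /hopfb -pauli_coord_rlinear; congr pauli_coord.
  case: c => /=; first by rewrite mulmxDr -scalemxAr.
  by rewrite dagD dagZ mulmxDr -scalemxAr.
case: c => /=; last by rewrite !mulmxDl -!scalemxAl.
by rewrite dagD dagZ !mulmxDl -!scalemxAl.
Qed.

Lemma hopfbE c : hopf c = (fun U => hopfb c U U).
Proof. by case: c. Qed.

Lemma dhopfE c U X : dhopf c U X = hopfb c U X + hopfb c X U.
Proof.
rewrite /hopfb -(rlinearD (@pauli_coord_rlinear R)) /dhopf.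
by congr pauli_coord; case: c; exact: addrC.
Qed.

End Forms.

(** * Real-bilinear maps under substitution and pairing *)

Section BilinearCombinators.
Context {R : realType} {E E' : lmodType R[i]} {F F' : normedModType R}.

Lemma rbilinear_comp (b : E -> E -> F) (m : E' -> E) :
  (forall (k : R) x y, m (k%:C *: x + y) = k%:C *: m x + m y) ->
  rbilinear b -> rbilinear (fun x y => b (m x) (m y)).
Proof. by move=> ml [bl br]; split=> x k y z; rewrite ml ?bl ?(br (m x)). Qed.

Lemma rbilinear_pair (b : E -> E -> F) (b' : E -> E -> F') :
  rbilinear b -> rbilinear b' -> rbilinear (fun x y => (b x y, b' x y)).
Proof.
move=> [bl br] [bl' br']; split=> x k y z; first by rewrite bl bl'.
by rewrite (br x) (br' x).
Qed.
End BilinearCombinators.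

(** * The Cartan form and its kernel *)

Section CartanForms.
Context {R : realType}.
Implicit Types (c : side) (l m : R) (b : 'rV[R]_3) (K : Mat R).

Lemma T_TSU2_T_SU2 (x u : Mat R * Mat R) : T_TSU2 x u -> T_SU2 x.1 u.1.
Proof. by case. Qed.

Lemma T_TSU2_lift (x : Mat R * Mat R) (X : Mat R) : SU2 R x.1 -> T_SU2 x.1 X ->
  exists2 v, T_TSU2 x v & v.1 = X.
Proof.
(* The fibre component is chosen to make the second component of [ltriv] vanish: it cancels X^*
   U'. *)
move=> hx hX; exists (X, - (x.1 *m (X ^t* *m x.2))) => //; split => //=.
by rewrite mulmxN SU2_VmulK // subrr; exact: su2_0.
Qed.

Lemma ltriv_rlinear (x : Mat R * Mat R) (k : R) u v :
  ltriv x (k%:C *: u + v) = k%:C *: ltriv x u + ltriv x v.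
Proof.
rewrite /ltriv /=; congr pair; first by rewrite mulmxDr -scalemxAr.
transitivity (k%:C *: (u.1 ^t* *m x.2 + x.1 ^t* *m u.2)
              + (v.1 ^t* *m x.2 + x.1 ^t* *m v.2)); last by [].
by rewrite dagD dagZ mulmxDl mulmxDr -scalemxAr -scalemxAl scalerDr addrACA.
Qed.

Lemma T_TSU2_0 (x : Mat R * Mat R) : T_TSU2 x 0.
Proof.
have e : ltriv x 0 = 0.
  have := ltriv_rlinear x (-1) 0 0.
  by rewrite scaler0 addr0 => ->; rewrite rmorphN rmorph1 scaleN1r addNr.
by change (su2 R (ltriv x 0).1 /\ su2 R (ltriv x 0).2); rewrite e;
  split; exact: su2_0.
Qed.

(* The kernel of the pulled-back form: the fibre directions together with the
   left-invariant direction i sigma3. *)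
Definition leaf_dir (x : Mat R * Mat R) : set (Mat R * Mat R) :=
  [set u | T_TSU2 x u /\ u1 R (x.1 ^t* *m u.1)].

Lemma char_dist_tau l : l != 0 -> forall x : Mat R * Mat R, TSU2 R x ->
  char_dist T_TSU2 (tau_dalpha l) x = leaf_dir x.
Proof.
move=> l0 x [hx _]; apply/seteqP; split=> u [hu h]; split => //.
  apply/(alpha_kernel l0 hx (T_TSU2_T_SU2 hu)) => Y hY.
  by have [v hv <-] := T_TSU2_lift hx hY; exact: h.
move=> v hv; move/(alpha_kernel l0 hx (T_TSU2_T_SU2 hu)): h; apply.
exact: T_TSU2_T_SU2.
Qed.

Lemma affine_dird {E : lmodType R[i]} (f : E -> R) (x u : E) (a b : R) :
  (forall t : R, f (x + t%:C *: u) = a + t * b) -> dird (f : E -> R^o) x u = b.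
Proof.
move=> h; apply: (@quad_dird _ _ _ _ _ _ (a : R^o) (b : R^o) 0) => t.
by rewrite scaler0 addr0 h.
Qed.

(** For L affine in the velocities, the fibre derivative is the pullback of [al] from the base and
    the potential drops out. As [al] is real-linear in the base point, the exterior derivative is a
    difference of two values. *)
Lemma cartan_of_form {E : lmodType R[i]} (L : E * E -> R) (al : E -> E -> R) :
  (forall (y : E * E) w (t : R),
    L (y.1, y.2 + t%:C *: w) = L (y.1, y.2) + t * al y.1 w) ->
  (forall w, rlinear (fun q => al q w : R^o)) ->
  forall x u v, cartan L x u v = - (al u.1 v.1 - al v.1 u.1).
Proof.
move=> Ll al_lin x u v.
have fE y w : fibre_form L y w = al y.1 w.1.
  by apply: (@affine_dird _ _ _ _ (L y)) => t; rewrite Ll -surjective_pairing.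
have e w : (fun y => fibre_form L y w : R^o) = (fun y => al y.1 w.1 : R^o).
  by apply/funext => y; rewrite fE.
rewrite /cartan /extd !e !rlinear_dird // => k y z; exact: (al_lin _ k y.1 z.1).
Qed.

Lemma energy_of_form {E : lmodType R[i]} (L : E * E -> R) (al : R) (x : E * E) :
  (forall t : R, L (x.1, x.2 + t%:C *: x.2) = L (x.1, x.2) + t * al) ->
  energy L x = al - L x.
Proof.
by move=> Ll; rewrite /energy (affine_dird Ll).
Qed.

Lemma alpha_line l U (X Y : Mat R) (t : R) :
  alpha l U (X + t%:C *: Y) = alpha l U X + t * alpha l U Y.
Proof. by rewrite addrC (alpha_rlinearr l U t Y X) addrC. Qed.

Lemma cartan1E c l m b (x u v : Mat R * Mat R) :
  cartan (lagrangian1 c l m b) x u v = - tau_dalpha l x u v.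
Proof.
rewrite /tau_dalpha extd_alphaE; apply: cartan_of_form.
  move=> y w t; rewrite /lagrangian1 /= alpha_line.
  by ring.
exact: alpha_rlinearl.
Qed.

Section TwoParticles.
Variables (c : side) (l1 l2 m1 m2 : R) (b : 'rV[R]_3) (K : Mat R).
Let L := lagrangian c l1 l2 m1 m2 b K.

Let alpha2 (q X : Mat R * Mat R) : R := alpha l1 q.1 X.1 + alpha l2 q.2 X.2.

Lemma lagrangian_line (q X Y : Mat R * Mat R) (t : R) :
  L (q, X + t%:C *: Y) = L (q, X) + t * alpha2 q Y.
Proof.
rewrite /L /lagrangian /alpha2 /= !alpha_line.
by move: (alpha l1 _ _) (alpha l2 _ _) (alpha l1 _ _) (alpha l2 _ _) (V1 _ _ _ _)
  (V1 _ _ _ _) (VI _ _ _) => *; ring.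
Qed.

Lemma cartanE (x u v : QQ R) : cartan L x u v =
  - (tau_dalpha l1 (part1 x) (part1 u) (part1 v)
     + tau_dalpha l2 (part2 x) (part2 u) (part2 v)).
Proof.
rewrite /tau_dalpha !extd_alphaE.
rewrite (cartan_of_form (fun y w t => lagrangian_line y.1 y.2 w t)).
  by rewrite /alpha2 /part1 /part2 /=; ring.
move=> X k q q'; rewrite /alpha2.
have /= -> := alpha_rlinearl l1 X.1 k q.1 q'.1.
have /= -> := alpha_rlinearl l2 X.2 k q.2 q'.2.
move: (alpha l1 q.1 _) (alpha l1 q'.1 _) (alpha l2 q.2 _) (alpha l2 q'.2 _).
by move=> *; rewrite scalerDr addrACA.
Qed.

Lemma energyE (x : QQ R) : energy L x = - V c m1 m2 b K x.1.
Proof.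
rewrite (energy_of_form (lagrangian_line x.1 x.2 x.2)).
by rewrite /alpha2 /L /lagrangian /V; move: (alpha l1 _ _) (alpha l2 _ _)
  (V1 _ _ _ _) (V1 _ _ _ _) (VI _ _ _) => *; ring.
Qed.

(** The form is a sum of one term per particle; test vectors that move a single particle isolate
    each term. *)
Lemma char_dist_cartan (x : QQ R) :
  char_dist T_TQ (cartan L) x =
  [set u | char_dist T_TSU2 (tau_dalpha l1) (part1 x) (part1 u) /\
           char_dist T_TSU2 (tau_dalpha l2) (part2 x) (part2 u)].
Proof.
have tau0 l (y u : Mat R * Mat R) : tau_dalpha l y u 0 = 0.
  rewrite /tau_dalpha extd_alphaE (rlinear0 (alpha_rlinearr l _)).
  by have /= -> := rlinear0 (alpha_rlinearl l u.1); rewrite subrr.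
apply/seteqP; split=> u.
  move=> [[h1 h2] h]; split; split => // v hv.
    have := h ((v.1, 0), (v.2, 0)); rewrite cartanE /part1 /part2 /=.
    rewrite -!surjective_pairing (tau0 l2) addr0 => H.
    by apply/eqP; rewrite -oppr_eq0 H //; split => //=;
      rewrite /part1 /part2 /= -?surjective_pairing //; exact: T_TSU2_0.
  have := h ((0, v.1), (0, v.2)); rewrite cartanE /part1 /part2 /=.
  rewrite -!surjective_pairing (tau0 l1) add0r => H.
  by apply/eqP; rewrite -oppr_eq0 H //; split => //=;
    rewrite /part1 /part2 /= -?surjective_pairing //; exact: T_TSU2_0.
move=> [[h1 k1] [h2 k2]]; split => // v [v1 v2].
by rewrite cartanE k1 // k2 // addr0 oppr0.
Qed.

Hypotheses (hl1 : l1 != 0) (hl2 : l2 != 0).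

Lemma char_dist_cartan_leaf (x : QQ R) : TQ R x ->
  char_dist T_TQ (cartan L) x =
  [set u | leaf_dir (part1 x) (part1 u) /\ leaf_dir (part2 x) (part2 u)].
Proof.
by move=> [x1 x2]; rewrite char_dist_cartan !char_dist_tau.
Qed.

Lemma ltriv_leaf_dir (x u : Mat R * Mat R) :
  leaf_dir x u <-> (u1 R `*` su2 R) (ltriv x u).
Proof.
split=> [[[h1 h2] h3]|[h1 h2]]; split => //.
by split => //; exact: u1_su2.
Qed.

(** The two equations of [ltriv] solved in turn: the base component first, then the fibre component,
    in which the base component enters. *)
Definition ltriv_inv (x a : Mat R * Mat R) : Mat R * Mat R :=
  (x.1 *m a.1, x.1 *m (a.2 - (x.1 *m a.1) ^t* *m x.2)).

Lemma ltriv_invK (x : Mat R * Mat R) :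
  TSU2 R x -> cancel (ltriv_inv x) (ltriv x).
Proof.
move=> [hx _] [a a']; rewrite /ltriv /ltriv_inv /=; congr pair;
  by rewrite SU2_VmulK // addrC subrK.
Qed.

Lemma ltrivK (x : Mat R * Mat R) : TSU2 R x -> cancel (ltriv x) (ltriv_inv x).
Proof.
move=> [hx _] [a a']; rewrite /ltriv /ltriv_inv /= SU2_KmulV //.
by rewrite addrAC subrr add0r SU2_KmulV.
Qed.

Lemma char_dist_ltriv (x : QQ R) : TQ R x ->
  real_iso (char_dist T_TQ (cartan L) x)
    ((u1 R `*` su2 R) `*` (u1 R `*` su2 R))
    (fun u => (ltriv (part1 x) (part1 u), ltriv (part2 x) (part2 u))).
Proof.
move=> hx; have [x1 x2] := hx; rewrite char_dist_cartan_leaf //; split; last first.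
  move=> k u v.
  exact: (f_equal2 pair (ltriv_rlinear (part1 x) k (part1 u) (part1 v))
                        (ltriv_rlinear (part2 x) k (part2 u) (part2 v))).
split.
- by move=> u [u1 u2]; split; [move/ltriv_leaf_dir: u1|move/ltriv_leaf_dir: u2].
- move=> u v _ _ e.
  have e1 : part1 u = part1 v by exact: (can_inj (ltrivK x1) (congr1 (fun p => p.1) e)).
  have e2 : part2 u = part2 v by exact: (can_inj (ltrivK x2) (congr1 (fun p => p.2) e)).
  move: e1 e2 => {e}; case: u v => [[u11 u12] [u21 u22]] [[v11 v12] [v21 v22]].
  by rewrite /part1 /part2 /= => -[-> ->] [-> ->].
- move=> [a a'] [ha ha'] /=.
  have e := ltriv_invK x1 a; have e' := ltriv_invK x2 a'.
  move: e e'; case: (ltriv_inv (part1 x) a) (ltriv_inv (part2 x) a').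
  move=> v1 v2 [w1 w2] e e'; exists ((v1, w1), (v2, w2)).
    split; apply/ltriv_leaf_dir.
      by rewrite -e in ha.
    by rewrite -e' in ha'.
  exact: (f_equal2 pair e e').
Qed.

End TwoParticles.
End CartanForms.

(** * Velocities and leaves *)

Section Velocity.
Context {R : realType}.

Lemma velocity_cst {E : lmodType R[i]} (e : E) t : velocity (fun=> e) t 0.
Proof.
move=> f fl; have -> : f 0 = 0 by exact: (@rlinear0 R E R^o f fl).
exact: is_derive_cst.
Qed.

Lemma velocityD {E : lmodType R[i]} (g h : R -> E) t v w :
  velocity g t v -> velocity h t w ->
  velocity (fun s => g s + h s) t (v + w).
Proof.
move=> gv hw f fl; rewrite (@rlinearD R E R^o f fl).
rewrite (_ : (fun s => _) = (fun s => f (g s) : R^o) + (fun s => f (h s) : R^o)).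
  by apply: is_deriveD; [exact: gv|exact: hw].
by apply/funext => s; rewrite (@rlinearD R E R^o f fl).
Qed.

Lemma velocityZ {E : lmodType R[i]} (c : R -> R) (g : R -> E) t c' v :
  is_derive t (1 : R) c c' -> velocity g t v ->
  velocity (fun s => (c s)%:C *: g s) t (c'%:C *: g t + (c t)%:C *: v).
Proof.
move=> cd gv f fl; rewrite fl (@rlinearZ R E R^o f fl).
rewrite (_ : (fun s => _) = (c : R -> R) * (fun s => f (g s) : R)).
  by apply: is_derive_eq (is_deriveM cd (gv f fl)) _; rewrite addrC mulrC.
by apply/funext => s; rewrite (@rlinearZ R E R^o f fl).
Qed.

Lemma velocity_linear {E E' : lmodType R[i]} (m : E -> E') (g : R -> E) t v :
  (forall (k : R) x y, m (k%:C *: x + y) = k%:C *: m x + m y) ->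
  velocity g t v -> velocity (fun s => m (g s)) t (m v).
Proof.
by move=> ml gv f fl; apply: (gv (fun x => f (m x))) => k x y; rewrite ml fl.
Qed.

(** A functional on the product is the sum of its restrictions to the two axes, so the pair is split
    as (x, 0) + (0, y). *)
Lemma velocity_pair {E E' : lmodType R[i]} (g : R -> E) (h : R -> E') t v w :
  velocity g t v -> velocity h t w ->
  velocity (fun s => (g s, h s)) t (v, w).
Proof.
move=> gv hw.
have e (x : E) (y : E') : (x, y) = (x, 0) + (0, y).
  by congr pair; rewrite ?addr0 ?add0r.
rewrite e (_ : (fun s => _) = (fun s => (g s, 0 : E') + (0 : E, h s))).
  apply: velocityD.
    apply: (velocity_linear (m := fun x => (x, 0 : E'))) gv => k x y.
    by congr pair; rewrite /= scaler0 addr0.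
  apply: (velocity_linear (m := fun x => (0 : E, x))) hw => k x y.
  by congr pair; rewrite /= scaler0 addr0.
by apply/funext => s; rewrite e.
Qed.

(** Velocities are determined only up to real-linear functionals; on matrices [mx_coord_inj] turns
    this into an equality. *)
Lemma velocity_uniq {E : lmodType R[i]} (g : R -> E) t v w :
  velocity g t v -> velocity g t w ->
  forall f : E -> R, rlinear (f : E -> R^o) -> f v = f w.
Proof.
move=> gv gw f fl; have [_ <-] := gv f fl; by have [_ <-] := gw f fl.
Qed.

Lemma expis3_velocity (a t : R) :
  velocity (fun s => expis3 (s * a)) t
    (expis3 (t * a) *m (a%:C *: ('i%C *: sigma3))).
Proof.
have d : is_derive t (1 : R) (fun s : R => s * a) a.
  rewrite (_ : (fun s => _) = a \*: (id : R -> R)).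
    apply: is_derive_eq; by rewrite /GRing.scale /= mulr1.
  by apply/funext => s; rewrite /= mulrC.
rewrite (_ : (fun s => _) = (fun s => (cos (s * a))%:C *: (1%:M : Mat R)
     + (sin (s * a))%:C *: ('i%C *: (sigma3 : Mat R)))); last first.
  by apply/funext => s; rewrite /expis3 scalerA [_ * 'i%C]mulrC.
have := velocityD
  (velocityZ (is_derive1_comp (f := cos) (is_derive_cos _) d)
     (velocity_cst (1%:M : Mat R) t))
  (velocityZ (is_derive1_comp (f := sin) (is_derive_sin _) d)
     (velocity_cst ('i%C *: (sigma3 : Mat R)) t)).
congr velocity; rewrite !scaler0 !addr0 expis3E u1E /sigma3 !mx2E.
by apply/mx2_eq; split; apply: complex_eq => /=; ring.
Qed.

End Velocity.

(** * Leaves of the kernel as fibres of the Hopf map *)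

Section Leaves.
Context {R : realType}.
Implicit Types (A B U X Y h : Mat R) (c : side) (l : R).

Definition mx_coord (k : 'I_2 * 'I_2 * bool) (A : Mat R) : R :=
  let z := A k.1.1 k.1.2 in if k.2 then complex.Re z else complex.Im z.

Definition mx_basis (k : 'I_2 * 'I_2 * bool) : Mat R :=
  (if k.2 then 1 else 'i%C) *: delta_mx k.1.1 k.1.2.

Lemma mx_coord_rlinear k : rlinear (mx_coord k : Mat R -> R^o).
Proof.
move=> a A B; rewrite /mx_coord !mxE.
case: (A _ _) (B _ _) => [x y] [x' y'] /=.
by case: (k.2) => /=; rewrite mul0r ?subr0 ?addr0.
Qed.

Lemma mx_coord_sum A : A = \sum_k (mx_coord k A)%:C *: mx_basis k.
Proof.
rewrite {1}[A]matrix_sum_delta pair_bigA /= (eq_bigl xpredT) //.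
rewrite -(pair_bigA _ (fun p b => (mx_coord (p, b) A)%:C *: mx_basis (p, b))) /=.
apply: eq_bigr => -[i j] _; rewrite big_bool /mx_coord /mx_basis /= !scalerA.
by rewrite -scalerDl mulr1 [_ * 'i%C]mulrC -complexE.
Qed.

Lemma is_derive_bigsum (I : Type) (r : seq I) (f : I -> R -> R^o) (df : I -> R^o)
    (t : R) : (forall k, is_derive t (1 : R) (f k) (df k)) ->
  is_derive t (1 : R) (fun s => \sum_(k <- r) f k s) (\sum_(k <- r) df k).
Proof.
move=> fd; elim: r => [|k r ih].
  by under eq_fun do rewrite big_nil; rewrite big_nil; exact: is_derive_cst.
by under eq_fun do rewrite big_cons; rewrite big_cons; exact: is_deriveD.
Qed.

(* Velocities are only tested against linear functionals, whence the expansion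
   of the first argument in a real basis. *)
Lemma velocity_rbilinear (b : Mat R -> Mat R -> R^o) (g : R -> Mat R) t v :
  rbilinear b -> velocity g t v ->
  is_derive t (1 : R) (fun s => b (g s) (g s)) (b v (g t) + b (g t) v).
Proof.
move=> [bl br] gv.
have bE A B : b A B = \sum_k mx_coord k A * b (mx_basis k) B.
  by rewrite {1}[A]mx_coord_sum; have /= -> := rlinear_sum (br B).
under eq_fun do rewrite bE.
rewrite [b v _]bE [b (g t) v]bE -big_split /=.
suff H k : is_derive t (1 : R) (fun s => mx_coord k (g s) * b (mx_basis k) (g s) : R^o)
    (mx_coord k v * b (mx_basis k) (g t) + mx_coord k (g t) * b (mx_basis k) v).
  have := is_derive_bigsum (index_enum _) H.
  by [].
have h1 : is_derive t (1 : R) (fun s => mx_coord k (g s) : R^o) (mx_coord k v).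
  exact: (gv _ (mx_coord_rlinear k)).
have h2 := gv _ (bl (mx_basis k)).
have -> : mx_coord k v * b (mx_basis k) (g t) + mx_coord k (g t) * b (mx_basis k) v
    = mx_coord k (g t) *: b (mx_basis k) v + b (mx_basis k) (g t) *: (mx_coord k v : R^o).
  by rewrite addrC; congr (_ + _); exact: mulrC.
exact: (is_deriveM h1 h2).
Qed.

Lemma row_lin n j (k : R) (u v : 'rV[R]_n) : (k *: u + v) 0 j = k * u 0 j + v 0 j.
Proof. by rewrite !mxE. Qed.

Lemma hopfb_coord_rbilinear c j :
  rbilinear (fun U V => hopfb c U V 0 j : R^o).
Proof.
have [bl br] := @hopfb_rbilinear R c.
split=> [U|V] k X Y; first by rewrite (bl U) row_lin.
by have /= -> := br V k X Y; rewrite row_lin.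
Qed.

Lemma leaf_hopf (x y : Mat R * Mat R) :
  leaf_rel (TSU2 R) leaf_dir x y -> hopf Rgt x.1 = hopf Rgt y.1.
Proof.
case=> g [<- <- gP]; rewrite hopfbE; apply/rowP => j.
apply: (@is_derive_0_is_cst R (fun s => hopfb Rgt (g s).1 (g s).1 0 j)) => t.
have [[hU _] [v [hv hv1] vel]] := gP t.
have vel1 : velocity (fun s => (g s).1) t v.1.
  exact: (velocity_linear (m := fun z : Mat R * Mat R => z.1)) vel.
have h := velocity_rbilinear (@hopfb_coord_rbilinear Rgt j) vel1.
have [_ /(_ hv1)] := dhopf_eq0 hU (T_TSU2_T_SU2 hv).
rewrite dhopfE -[hopfb _ _ v.1]scale1r => /rowP/(_ j).
rewrite row_lin mul1r addrC [in X in _ = X]mxE => e.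
by rewrite -e; exact: h.
Qed.

Lemma expis3_0 : expis3 0 = 1%:M :> Mat R.
Proof. by rewrite expis3E cos0 sin0 oppr0 !mx2E. Qed.

Lemma hopf_leaf (x y : Mat R * Mat R) : TSU2 R x -> TSU2 R y ->
  hopf Rgt x.1 = hopf Rgt y.1 -> leaf_rel (TSU2 R) leaf_dir x y.
Proof.
move=> [hx tx] [hy ty] /(hopf_fibre Rgt hx hy)[_ [a _ <-] /= xy].
(* A and B are the left-trivialized velocities of the endpoints. Interpolating them, rather than the
   velocities themselves, keeps the curve tangent to the group, since su(2) is a real vector
   space. *)
pose A := x.1 ^t* *m x.2; pose B := y.1 ^t* *m y.2.
pose W := a%:C *: ('i%C *: (sigma3 : Mat R)).
have hW : u1 R W by exists a.
pose G s := x.1 *m expis3 (s * a); pose M s := A + s%:C *: (B - A).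
have hM s : su2 R (M s).
  rewrite /M addrC; apply: su2_rlinear => //.
  have -> : B - A = (-1)%:C *: A + B by rewrite rmorphN rmorph1 scaleN1r addrC.
  exact: su2_rlinear.
have hG s : SU2 R (G s) by apply: SU2_mul => //; apply: U1_SU2; exists (s * a).
exists (fun s => (G s, G s *m M s)); split.
- rewrite /G /M mul0r expis3_0 mulmx1 scale0r addr0 /A SU2_KmulV //.
  by rewrite -surjective_pairing.
- rewrite /G /M mul1r xy scale1r addrC subrK /B SU2_KmulV //.
  by rewrite -surjective_pairing.
move=> t; split; first by split; [exact: hG|exact: (T_SU2_mul (hG t) (hM t))].
pose v1 := G t *m W.
have vG : velocity G t v1.
  rewrite /v1 /G -mulmxA.
  apply: (velocity_linear (m := mulmx x.1)) (expis3_velocity a t) => k X Y.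
  by rewrite mulmxDr -scalemxAr.
have vmul (C : Mat R) : velocity (fun s => G s *m C) t (v1 *m C).
  apply: (velocity_linear (m := fun X : Mat R => X *m C) _ vG) => k X Y.
  by rewrite mulmxDl -scalemxAl.
(* The product rule for G(t) (A + t (B - A)), kept in the unsimplified shape that [velocityD] and
   [velocityZ] produce. *)
pose v2 := v1 *m A + ((1 : R)%:C *: (G t *m (B - A)) + t%:C *: (v1 *m (B - A))).
exists (v1, v2); last first.
  apply: (velocity_pair vG).
  rewrite (_ : (fun s => _) = (fun s => G s *m A + s%:C *: (G s *m (B - A)))).
    by apply: velocityD => //; exact: (velocityZ (c := id)).
  by apply/funext => s; rewrite /M mulmxDr -scalemxAr.
have eW : (G t) ^t* *m v1 = W by rewrite /v1 SU2_VmulK.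
have eWd : v1 ^t* *m G t = - W.
  by rewrite /v1 dagM SU2_mulVK // (proj1 (u1_su2 hW)).
have hMA : su2 R (B - A).
  have -> : B - A = (-1)%:C *: A + B by rewrite rmorphN rmorph1 scaleN1r addrC.
  exact: su2_rlinear.
clearbody v1 G.
(* In the second component of [ltriv] the term W M(t) cancels against v1^* G M = - W M, leaving B -
   A, which is in su(2). *)
have e2 : (G t) ^t* *m v2 = W *m M t + (B - A).
  rewrite /v2 2!mulmxDr -2!scalemxAr !(mulmxA ((G t) ^t*)) eW.
  rewrite (proj2 (SU2_unitary (hG t))) mul1mx rmorph1 scale1r /M (mulmxDr W A) -scalemxAr.
  by rewrite addrA addrAC.
split; last by rewrite /= eW.
split; first by rewrite /= eW; exact: u1_su2.
by rewrite /= mulmxA eWd e2 mulNmx addrA addNr add0r.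
Qed.

Lemma leaf_relP (x y : Mat R * Mat R) : TSU2 R x -> TSU2 R y ->
  hopf Rgt x.1 = hopf Rgt y.1 <-> leaf_rel (TSU2 R) leaf_dir x y.
Proof. by move=> hx hy; split; [exact: hopf_leaf|exact: leaf_hopf]. Qed.

(** The curve that joins two points stays in M, so the distribution matters only there. *)
Lemma leaf_rel_eq {E : lmodType R[i]} (M : set E) (D D' : E -> set E) x y :
  (forall z, M z -> D z = D' z) -> leaf_rel M D x y <-> leaf_rel M D' x y.
Proof.
move=> DD; split=> -[g [g0 g1 gP]]; exists g; split => // t;
  have [hM [v hv vel]] := gP t; split => //; exists v => //.
  by rewrite -DD.
by rewrite DD.
Qed.

Definition leaf_dir2 (x : QQ R) : set (QQ R) :=
  [set u | leaf_dir (part1 x) (part1 u) /\ leaf_dir (part2 x) (part2 u)].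

(** Leaves of the composite system are products of leaves: the joining curves all run from time 0 to
    time 1, so two of them pair up without reparametrization. This is what makes the reduced state
    space a Cartesian product. *)
Lemma leaf_rel2P (x y : QQ R) : leaf_rel (TQ R) leaf_dir2 x y <->
  leaf_rel (TSU2 R) leaf_dir (part1 x) (part1 y) /\
  leaf_rel (TSU2 R) leaf_dir (part2 x) (part2 y).
Proof.
split=> [[g [<- <- gP]]|[[g [g0 g1 gP]] [h [h0 h1 hP]]]].
  split; [exists (fun t => part1 (g t))|exists (fun t => part2 (g t))];
    split => // t; have [[M1 M2] [v [v1 v2] vel]] := gP t; split => //.
    by exists (part1 v) => //; exact: (velocity_linear (m := @part1 R)).
  by exists (part2 v) => //; exact: (velocity_linear (m := @part2 R)).
exists (fun t => (((g t).1, (h t).1), ((g t).2, (h t).2))); split.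
- rewrite g0 h0 /part1 /part2 /=; case: (x) => [[? ?] [? ?]] //.
- rewrite g1 h1 /part1 /part2 /=; case: (y) => [[? ?] [? ?]] //.
move=> t; have [M1 [v v1 gv]] := gP t; have [M2 [w w1 hw]] := hP t.
split; first by split; rewrite /part1 /part2 /= -surjective_pairing.
exists ((v.1, w.1), (v.2, w.2)).
  by split; rewrite /part1 /part2 /= -!surjective_pairing.
by apply: velocity_pair; apply: velocity_pair;
  [exact: (velocity_linear (m := fst)) gv|exact: (velocity_linear (m := fst)) hw|
   exact: (velocity_linear (m := snd)) gv|exact: (velocity_linear (m := snd)) hw].
Qed.

End Leaves.

(** * Quotient manifolds *)

Section Quotients.
Context {R : realType}.
Implicit Types (c : side) (l m : R) (b : 'rV[R]_3) (K : Mat R).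

Definition hopf2b c (q q' : Mat R * Mat R) : VV R :=
  (hopfb c q.1 q'.1, hopfb c q.2 q'.2).

Definition dhopf2 c (q u : Mat R * Mat R) : VV R :=
  (dhopf c q.1 u.1, dhopf c q.2 u.2).

Lemma hopf2b_rbilinear c : rbilinear (hopf2b c).
Proof.
apply: rbilinear_pair.
  exact: (rbilinear_comp (m := fun q : Mat R * Mat R => q.1) _ (hopfb_rbilinear c)).
exact: (rbilinear_comp (m := fun q : Mat R * Mat R => q.2) _ (hopfb_rbilinear c)).
Qed.

Lemma hopf2bE c : hopf2 c = (fun q => hopf2b c q q).
Proof. by rewrite /hopf2 !hopfbE. Qed.

Lemma dhopf2E c q u : dhopf2 c q u = hopf2b c q u + hopf2b c u q.
Proof. by rewrite /dhopf2 !dhopfE. Qed.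

Lemma hopf2_dird c q u : dird (hopf2 c) q u = dhopf2 c q u.
Proof.
by rewrite hopf2bE rbilinear_dird ?dhopf2E //; exact: hopf2b_rbilinear.
Qed.

Lemma hopf2_quotient c : is_quotient_manifold (Q R) T_Q (orbit_rel c)
  (S2xS2 R) T_S2xS2 (hopf2 c).
Proof.
split.
- by rewrite hopf2bE; apply: smooth_rbilinear; exact: hopf2b_rbilinear.
- apply/seteqP; split=> [_ [q [q1 q2] <-]|[n n'] [h h']].
    by split; exact: hopf_S2.
  have [U hU eU] := hopf_surj c h; have [U' hU' eU'] := hopf_surj c h'.
  by exists (U, U') => //; rewrite /hopf2 /= eU eU'.
- move=> q q' [q1 q2] [q1' q2']; split=> [e|[h [h1 h2] <-]].
    have [h h1 e1] := proj1 (hopf_fibre c q1 q1') (congr1 (fun p => p.1) e).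
    have [h' h1' e1'] := proj1 (hopf_fibre c q2 q2') (congr1 (fun p => p.2) e).
    exists (h, h'); first by split.
    exact: etrans (f_equal2 pair e1 e1') (esym (surjective_pairing q')).
  by rewrite /hopf2 /act /= !hopfE !spin_act1.
- move=> q [q1 q2]; apply/seteqP; split=> [_ [u [u1 u2] <-]|[v v'] [h h']].
    by rewrite hopf2_dird; split; exact: dhopf_T_S2.
  have [X hX eX] := dhopf_surj q1 h; have [Y hY eY] := dhopf_surj q2 h'.
  by exists (X, Y) => //; rewrite hopf2_dird /dhopf2 /= eX eY.
Qed.

Lemma is_quotient_manifold_rel {E : lmodType R[i]} {F : normedModType R}
    (M : set E) (T : E -> set E) (rel rel' : E -> E -> Prop)
    (N : set F) (TN : F -> set F) (p : E -> F) :
  (forall x y, M x -> M y -> rel x y <-> rel' x y) ->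
  is_quotient_manifold M T rel N TN p -> is_quotient_manifold M T rel' N TN p.
Proof.
move=> rr [h1 h2 h3 h4]; split => // x y hx hy.
by rewrite (h3 x y hx hy); exact: rr.
Qed.

Lemma TSU2_0 (U : Mat R) : SU2 R U -> TSU2 R (U, 0).
Proof. by move=> hU; split => //; rewrite /T_SU2 /= mulmx0; exact: su2_0. Qed.

Lemma TSU2_quotient : is_quotient_manifold (TSU2 R) T_TSU2
  (leaf_rel (TSU2 R) leaf_dir) (S2 R) T_S2 (fun x => hopf Rgt x.1).
Proof.
have bb : rbilinear (fun x y : Mat R * Mat R => hopfb Rgt x.1 y.1).
  exact: (rbilinear_comp (m := fun q : Mat R * Mat R => q.1) _ (hopfb_rbilinear Rgt)).
have d x u : dird (fun x : Mat R * Mat R => hopf Rgt x.1) x u = dhopf Rgt x.1 u.1.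
  by rewrite dhopfE -(rbilinear_dird bb).
split.
- exact: smooth_rbilinear bb.
- apply/seteqP; split=> [_ [x [hx _] <-]|n /(hopf_surj Rgt)[U hU <-]].
    exact: hopf_S2.
  by exists (U, 0) => //; exact: TSU2_0.
- exact: leaf_relP.
- move=> x [hx _]; apply/seteqP; split=> [_ [u hu <-]|v /(dhopf_surj hx)[X hX <-]].
    by rewrite d; apply: dhopf_T_S2 => //; exact: T_TSU2_T_SU2.
  by have [u hu <-] := T_TSU2_lift hx hX; exists u => //; exact: d.
Qed.

Lemma T_TQ_lift (x : QQ R) (q : Mat R * Mat R) : TQ R x -> T_Q x.1 q ->
  exists2 v, T_TQ x v & v.1 = q.
Proof.
move=> [[h1 _] [h2 _]] [q1 q2].
have [v hv e] := T_TSU2_lift (x := part1 x) h1 q1.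
have [w hw e'] := T_TSU2_lift (x := part2 x) h2 q2.
exists ((v.1, w.1), (v.2, w.2)); last by rewrite /= e e' -surjective_pairing.
by split; rewrite /part1 /part2 /= -surjective_pairing.
Qed.

Lemma TQ_Q (x : QQ R) : TQ R x -> Q R x.1.
Proof. by move=> [[h1 _] [h2 _]]; exact: (conj h1 h2). Qed.

Lemma T_TQ_T_Q (x u : QQ R) : T_TQ x u -> T_Q x.1 u.1.
Proof. by move=> [[h1 _] [h2 _]]; exact: (conj h1 h2). Qed.

(** The map factors through the projection to Q, so its image and the images of tangent spaces are
    those of [hopf2], while its fibres are described one particle at a time by the leaves. *)
Lemma TQ_quotient : is_quotient_manifold (TQ R) T_TQ
  (leaf_rel (TQ R) leaf_dir2) (S2xS2 R) T_S2xS2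
  (fun x => (hopf Rgt (part1 x).1, hopf Rgt (part2 x).1)).
Proof.
have bb : rbilinear (fun x y : QQ R => hopf2b Rgt x.1 y.1).
  exact: (rbilinear_comp (m := fun q : QQ R => q.1) _ (hopf2b_rbilinear Rgt)).
have d x u : dird (fun x : QQ R => hopf2 Rgt x.1) x u = dhopf2 Rgt x.1 u.1.
  by rewrite dhopf2E -(rbilinear_dird bb) hopf2bE.
have [_ im _ dim] := hopf2_quotient Rgt.
have -> : (fun x : QQ R => (hopf Rgt (part1 x).1, hopf Rgt (part2 x).1)) =
  (fun x => hopf2 Rgt x.1) by [].
split.
- by rewrite hopf2bE; exact: smooth_rbilinear bb.
- rewrite -im; apply/seteqP; split=> [_ [x hx <-]|_ [q [q1 q2] <-]].
    by exists x.1 => //; exact: TQ_Q.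
  by exists (q, (0, 0)) => //; split; exact: TSU2_0.
- move=> x y [x1 x2] [y1 y2]; split=> [e|/leaf_rel2P[h1 h2]].
    have e1 : hopf Rgt (part1 x).1 = hopf Rgt (part1 y).1 := congr1 (fun p => p.1) e.
    have e2 : hopf Rgt (part2 x).1 = hopf Rgt (part2 y).1 := congr1 (fun p => p.2) e.
    exact: (proj2 (leaf_rel2P x y) (conj (hopf_leaf x1 y1 e1) (hopf_leaf x2 y2 e2))).
  exact: (f_equal2 pair (leaf_hopf h1) (leaf_hopf h2)).
- move=> x hx; rewrite -[RHS](dim _ (TQ_Q hx)); apply/seteqP.
  split=> [_ [u hu <-]|_ [q hq <-]].
    by exists u.1; [exact: T_TQ_T_Q|rewrite d hopf2_dird].
  have [u hu <-] := T_TQ_lift hx hq.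
  by exists u => //; rewrite d hopf2_dird.
Qed.

Lemma closed_form2_cst {E : lmodType R[i]} (M : set E) (T : E -> set E)
    (w : form2 R E) :
  (forall x y u v, w x u v = w y u v) -> closed_form2 M T w.
Proof.
move=> w_cst x u v z _ _ _ _.
have d y y' s : dird (fun q => w q y y' : R^o) x s = 0.
  apply: (@affine_dird _ _ _ _ _ (w x y y')) => t.
  by rewrite mulr0 addr0; exact: w_cst.
by rewrite !d subrr addr0.
Qed.

Lemma omega_closed l1 l2 : closed_form2 (Q R) T_Q (omega l1 l2).
Proof. by apply: closed_form2_cst => x y u v; rewrite /omega !extd_alphaE. Qed.

Lemma mx_coord_inj (A B : Mat R) : (forall k, mx_coord k A = mx_coord k B) -> A = B.
Proof.
by move=> h; rewrite [A]mx_coord_sum [B]mx_coord_sum; apply: eq_bigr => k _; rewrite h.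
Qed.

Lemma act_velocity (q : Mat R * Mat R) (s1 s2 : R) :
  velocity (fun t => act Rgt (expis3 (t * s1), expis3 (t * s2)) q) 0
    (q.1 *m (s1%:C *: ('i%C *: sigma3)), q.2 *m (s2%:C *: ('i%C *: sigma3))).
Proof.
have h (U : Mat R) s : velocity (fun t => U *m expis3 (t * s)) 0
    (U *m (s%:C *: ('i%C *: sigma3))).
  have := expis3_velocity s 0; rewrite mul0r expis3_0 mul1mx.
  by apply: (velocity_linear (m := mulmx U)) => k X Y; rewrite mulmxDr -scalemxAr.
by apply: velocity_pair; exact: h.
Qed.

Lemma char_dist_omega l1 l2 (q : Mat R * Mat R) : l1 != 0 -> l2 != 0 -> Q R q ->
  char_dist T_Q (omega l1 l2) q = orbit_dir Rgt q.
Proof.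
move=> l10 l20 [q1 q2]; apply/seteqP; split=> u.
  move=> [[h1 h2] h].
  have e0 l (U X : Mat R) : extd (alpha l) U X 0 = 0.
    rewrite extd_alphaE (rlinear0 (alpha_rlinearr l X)).
    by have /= -> := rlinear0 (alpha_rlinearl l X); rewrite subrr.
  have T0 (U : Mat R) : T_SU2 U 0 by rewrite /T_SU2 /= mulmx0; exact: su2_0.
  have : u1 R (q.1 ^t* *m u.1).
    apply/(alpha_kernel l10 q1 h1) => Y hY.
    by have := h (Y, 0); rewrite /omega /= e0 addr0; apply; split.
  have : u1 R (q.2 ^t* *m u.2).
    apply/(alpha_kernel l20 q2 h2) => Y hY.
    by have := h (0, Y); rewrite /omega /= e0 add0r; apply; split.
  move=> [s2 _ e2] [s1 _ e1]; exists s1, s2.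
  have := act_velocity q s1 s2; rewrite /= in e1 e2; rewrite e1 e2.
  by rewrite !SU2_KmulV // -surjective_pairing.
move=> [s1 [s2 vel]].
(* A member of [orbit_dir] is only known as some velocity of the orbit curve; comparison with the
   computed one identifies it coordinate by coordinate. *)
have E := velocity_uniq vel (act_velocity q s1 s2).
have e1 : u.1 = q.1 *m (s1%:C *: ('i%C *: sigma3)).
  apply: mx_coord_inj => k.
  by apply: (E (fun x => mx_coord k x.1)) => a X Y; exact: (mx_coord_rlinear k).
have e2 : u.2 = q.2 *m (s2%:C *: ('i%C *: sigma3)).
  apply: mx_coord_inj => k.
  by apply: (E (fun x => mx_coord k x.2)) => a X Y; exact: (mx_coord_rlinear k).
have u1s s : u1 R (s%:C *: ('i%C *: sigma3)) by exists s.
have t1 : T_SU2 q.1 u.1 by rewrite e1; apply: T_SU2_mul => //; exact/u1_su2/u1s.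
have t2 : T_SU2 q.2 u.2 by rewrite e2; apply: T_SU2_mul => //; exact/u1_su2/u1s.
split; first by split.
move=> v [v1 v2]; rewrite /omega.
rewrite (proj2 (alpha_kernel l10 q1 t1)) ?(proj2 (alpha_kernel l20 q2 t2)) ?addr0 //.
  by rewrite e2 SU2_VmulK.
by rewrite e1 SU2_VmulK.
Qed.

Lemma omega_omega_red l1 l2 (q u v : Mat R * Mat R) : l1 != 0 -> l2 != 0 ->
  Q R q -> T_Q q u -> T_Q q v ->
  omega l1 l2 q u v = omega_red l1 l2 (hopf2 Rgt q) (dhopf2 Rgt q u) (dhopf2 Rgt q v).
Proof.
move=> l10 l20 [q1 q2] [u1 u2] [v1 v2].
rewrite /omega /omega_red !area_triple //.
have -> := extd_alpha_triple l1 q1 u1 v1; have -> := extd_alpha_triple l2 q2 u2 v2.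
by rewrite !mulNr -opprD.
Qed.

End Quotients.

(** * Reduced dynamics *)

Section Dynamics.
Context {R : realType}.
Implicit Types (c : side) (l m : R) (b u v w n : 'rV[R]_3) (K A B : Mat R).

(** The potentials as functions of arbitrary matrices in place of the spin matrices: [zeeman] is
    real-linear and [coupling] real-bilinear. *)
Definition zeeman m b A : R := complex.Re (m%:C * \tr (A *m pauli b)).
Definition coupling K A B : R := complex.Re (\tr (A *m K *m B)).

Lemma zeeman_rlinear m b (k : R) A B :
  zeeman m b (k%:C *: A + B) = k * zeeman m b A + zeeman m b B.
Proof.
by rewrite /zeeman mulmxDl -scalemxAl mxtraceD mxtraceZ mulrDr mulrCA Re_rlinear.
Qed.

Lemma coupling_rlinearl K (k : R) A A' B :
  coupling K (k%:C *: A + A') B = k * coupling K A B + coupling K A' B.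
Proof. by rewrite /coupling !mulmxDl -!scalemxAl mxtraceD mxtraceZ Re_rlinear. Qed.

Lemma coupling_rlinearr K (k : R) A B B' :
  coupling K A (k%:C *: B + B') = k * coupling K A B + coupling K A B'.
Proof. by rewrite /coupling mulmxDr -scalemxAr mxtraceD mxtraceZ Re_rlinear. Qed.

Definition zeeman_vec m b v : R := zeeman m b (pauli v).
Definition exchange K u v : R := coupling K (pauli u) (pauli v).

Lemma zeeman_vec_rlinear m b (k : R) u v :
  zeeman_vec m b (k *: u + v) = k * zeeman_vec m b u + zeeman_vec m b v.
Proof. by rewrite /zeeman_vec pauli_rlinear zeeman_rlinear. Qed.

Lemma exchange_rlinearl K (k : R) u u' v :
  exchange K (k *: u + u') v = k * exchange K u v + exchange K u' v.
Proof. by rewrite /exchange pauli_rlinear coupling_rlinearl. Qed.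

Lemma exchange_rlinearr K (k : R) u v v' :
  exchange K u (k *: v + v') = k * exchange K u v + exchange K u v'.
Proof. by rewrite /exchange pauli_rlinear coupling_rlinearr. Qed.

Lemma exchange_oppr K u v : exchange K u (- v) = - exchange K u v.
Proof.
have J0 : exchange K u 0 = 0.
  by have := exchange_rlinearr K (-1) u 0 0; rewrite scaler0 addr0 mulN1r addNr.
by rewrite -[- v]addr0 -scaleN1r exchange_rlinearr J0 addr0 mulN1r.
Qed.

Lemma linear_grad (f : 'rV[R]_3 -> R) :
  (forall (k : R) u v, f (k *: u + v) = k * f u + f v) ->
  forall v, f v = dot (\row_j f (delta_mx 0 j)) v.
Proof.
move=> fl v; have f0 : f 0 = 0.
  by have := fl (-1) 0 0; rewrite scaler0 addr0 mulN1r addNr.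
rewrite {1}[v]row_sum_delta /dot.
have -> (r : seq 'I_3) : f (\sum_(j <- r) v 0 j *: delta_mx 0 j) =
    \sum_(j <- r) v 0 j * f (delta_mx 0 j).
  by elim: r => [|j r ih]; rewrite ?big_nil // !big_cons fl ih.
by apply: eq_bigr => j _; rewrite mxE mulrC.
Qed.

Section Reduced.
Variables (l1 l2 m1 m2 : R) (b : 'rV[R]_3) (K : Mat R).

Definition dV_red (n v : VV R) : R :=
  zeeman_vec m1 b v.1 + exchange K v.1 n.2 + (zeeman_vec m2 b v.2 + exchange K n.1 v.2).

Lemma V_redE (n : VV R) :
  V_red m1 m2 b K n = zeeman_vec m1 b n.1 + zeeman_vec m2 b n.2 + exchange K n.1 n.2.
Proof. by []. Qed.

Lemma V_red_deriv (n v : VV R) :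
  'D_v (V_red m1 m2 b K : VV R -> R^o) n = dV_red n v.
Proof.
have h (t : R) : V_red m1 m2 b K (t *: v + n) =
    V_red m1 m2 b K n + t * dV_red n v + t ^+ 2 * exchange K v.1 v.2.
  rewrite !V_redE /dV_red /= !zeeman_vec_rlinear !exchange_rlinearl !exchange_rlinearr.
  move: (zeeman_vec _ _ _) (zeeman_vec _ _ _) (zeeman_vec _ _ _) (zeeman_vec _ _ _)
    (exchange _ _ _) (exchange _ _ _) (exchange _ _ _) (exchange _ _ _).
  by move=> *; ring.
have c : {for 0, continuous (fun _ : R => exchange K v.1 v.2 : R^o)}.
  exact: cst_continuous.
have := taylor_cvg (p := fun t => V_red m1 m2 b K (t *: v + n) : R^o)
  (A := V_red m1 m2 b K n : R^o) (B := dV_red n v : R^o) c h.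
rewrite scale0r add0r => cv.
exact: cvg_lim cv.
Qed.

Definition grad1 (n : VV R) : 'rV[R]_3 :=
  \row_j (zeeman_vec m1 b (delta_mx 0 j) + exchange K (delta_mx 0 j) n.2).
Definition grad2 (n : VV R) : 'rV[R]_3 :=
  \row_j (zeeman_vec m2 b (delta_mx 0 j) + exchange K n.1 (delta_mx 0 j)).

Lemma dV_red_grad (n v : VV R) :
  dV_red n v = dot (grad1 n) v.1 + dot (grad2 n) v.2.
Proof.
congr (_ + _).
  apply: (linear_grad (f := fun v => zeeman_vec m1 b v + exchange K v n.2)) => k x y.
  by rewrite zeeman_vec_rlinear exchange_rlinearl mulrDr addrACA.
apply: (linear_grad (f := fun v => zeeman_vec m2 b v + exchange K n.1 v)) => k x y.
by rewrite zeeman_vec_rlinear exchange_rlinearr mulrDr addrACA.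
Qed.

(* On each sphere this is the Landau-Lifshitz equation n' = n x grad V / l. *)
Definition ham_field (n : VV R) : VV R :=
  (l1^-1 *: cross n.1 (grad1 n), l2^-1 *: cross n.2 (grad2 n)).

Hypotheses (hl1 : l1 != 0) (hl2 : l2 != 0).

Lemma omega_redE (n u v : VV R) : omega_red l1 l2 n u v =
  - (l1 * dot n.1 (cross u.1 v.1) + l2 * dot n.2 (cross u.2 v.2)).
Proof. by rewrite /omega_red !area_triple. Qed.

Lemma dotZ u v (k : R) : dot u (k *: v) = k * dot u v.
Proof. by rewrite /dot mulr_sumr; apply: eq_bigr => j _; rewrite mxE mulrCA. Qed.

Lemma dotN u v : dot u (- v) = - dot u v.
Proof. by rewrite -scaleN1r dotZ mulN1r. Qed.

Lemma dotD u v w : dot u (v + w) = dot u v + dot u w.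
Proof. by rewrite -{1}[v]scale1r dot_rlinear mul1r. Qed.

Lemma cross_scaler n v (k : R) : cross n (k *: v) = k *: cross n v.
Proof.
elim/(@vec3P R): n => x y z; elim/(@vec3P R): v => x' y' z'.
rewrite /cross vec3_scale !vec3E vec3_scale.
by congr vec3; ring.
Qed.

(** The triple product becomes v . (n x (n x g)) = (n . g) (n . v) - g . v, and v is tangent. The
    normal part of g thus drops out, so the ambient gradient can be used without projecting it. *)
Lemma triple_gradient l n v g : l != 0 -> S2 R n -> T_S2 n v ->
  l * dot n (cross (l^-1 *: cross n g) v) = - dot g v.
Proof.
move=> l0 /S2P n1 /T_S2P nv.
rewrite triple_swap cross_scaler cross_cross n1 scale1r dotZ dotD dotN dotZ.
by rewrite (dotC v n) nv mulr0 add0r mulrA divff // mul1r dotC.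
Qed.

Lemma ham_field_hamiltonian : hamiltonian_field (S2xS2 R) T_S2xS2
  (omega_red l1 l2) (V_red m1 m2 b K) ham_field.
Proof.
move=> n [n1 n2]; split.
  by split; apply/T_S2P; rewrite /= dotZ dot_cross0 mulr0.
move=> v [v1 v2]; rewrite V_red_deriv dV_red_grad omega_redE /=.
by rewrite !triple_gradient // opprD !opprK.
Qed.

Lemma crossBl u u' v : cross (u - u') v = cross u v - cross u' v.
Proof.
elim/(@vec3P R): u => x y z; elim/(@vec3P R): v => x' y' z'.
elim/(@vec3P R): u' => x'' y'' z''.
by rewrite /cross !vec3_opp !vec3_add !vec3E; congr vec3; ring.
Qed.

Lemma cross0r u : cross u 0 = 0.
Proof. by rewrite -[0](scale0r (0 : 'rV[R]_3)) cross_scaler !scale0r. Qed.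

Lemma dot0r u : dot u 0 = 0.
Proof. by rewrite /dot big1 // => j _; rewrite mxE mulr0. Qed.

(** Nondegeneracy of the reduced form, obtained on each sphere from test vectors that vanish on the
    other; it gives uniqueness of the Hamiltonian field. *)
Lemma omega_red_inj (n u u' : VV R) : S2xS2 R n -> T_S2xS2 n u -> T_S2xS2 n u' ->
  (forall v : VV R, T_S2xS2 n v -> omega_red l1 l2 n u v = omega_red l1 l2 n u' v) ->
  u = u'.
Proof.
move=> [n1 n2] [u1 u2] [u1' u2'] h.
have key l (p q r : 'rV[R]_3) : l != 0 -> S2 R p -> T_S2 p q -> T_S2 p r ->
    (forall v, T_S2 p v -> - (l * dot p (cross q v)) = - (l * dot p (cross r v))) ->
    q = r.
  move=> l0 p1 /T_S2P pq /T_S2P pr H; apply/eqP; rewrite -subr_eq0; apply/eqP.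
  apply: (triple_nondegenerate p1); first by apply/T_S2P; rewrite dotD dotN pq pr subrr.
  move=> v /H /oppr_inj /(mulfI l0) e.
  by rewrite crossBl dotD dotN e subrr.
have e1 : u.1 = u'.1.
  apply: (key l1 n.1) => // v hv; have := h (v, 0).
  rewrite !omega_redE /= !cross0r !dot0r !mulr0 !addr0; apply.
  by split => //; apply/T_S2P; exact: dot0r.
have e2 : u.2 = u'.2.
  apply: (key l2 n.2) => // v hv; have := h (0, v).
  rewrite !omega_redE /= !cross0r !dot0r !mulr0 !add0r; apply.
  by split => //; apply/T_S2P; exact: dot0r.
by rewrite [u]surjective_pairing [u']surjective_pairing e1 e2.
Qed.

Lemma ham_field_uniq (X : VV R -> VV R) : hamiltonian_field (S2xS2 R) T_S2xS2
    (omega_red l1 l2) (V_red m1 m2 b K) X ->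
  forall n : VV R, S2xS2 R n -> X n = ham_field n.
Proof.
move=> hX n hn; have [t1 e1] := hX n hn; have [t2 e2] := ham_field_hamiltonian hn.
by apply: (omega_red_inj hn) => // v hv; rewrite e1 // e2.
Qed.

Lemma S2_delta j : S2 R (delta_mx 0 j).
Proof.
rewrite /S2 /= (bigD1 j) //= big1 => [|i ij]; rewrite mxE eqxx ?eqxx /=.
  by rewrite expr1n addr0.
by rewrite (negPf ij) expr0n.
Qed.

Lemma dot_delta (i j : 'I_3) : i != j ->
  dot (delta_mx 0 i : 'rV[R]_3) (delta_mx 0 j) = 0.
Proof.
move=> ij; rewrite /dot big1 // => k _; rewrite !mxE !eqxx /=.
by have [->|_] := eqVneq k i; rewrite ?mul0r // (negPf ij) mulr0.
Qed.

Lemma S2_opp n : S2 R n -> S2 R (- n).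
Proof. by move=> /S2P h; apply/S2P; rewrite dotN dotC dotN opprK. Qed.

Lemma VI_hopf c (q : Mat R * Mat R) : Q R q ->
  VI c K q = exchange K (hopf c q.1) (hopf c q.2).
Proof.
move=> [q1 q2]; have := spin_pauli c q1; have := spin_pauli c q2.
by rewrite /exchange; move: (hopf c _) (hopf c _) => n n' -> ->.
Qed.

Lemma V1_hopf c m (U : Mat R) : SU2 R U -> V1 c m b U = zeeman_vec m b (hopf c U).
Proof.
by move=> hU; have := spin_pauli c hU; rewrite /zeeman_vec; move: (hopf c _) => n ->.
Qed.

Lemma ham_field_separable c :
  separable ham_field <-> forall q : Mat R * Mat R, Q R q -> VI c K q = 0.
Proof.
split=> [[X1 [X2 XE]] q [q1 q2]|h].
  rewrite (VI_hopf c (conj q1 q2)).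
  move: (hopf_S2 c q1) (hopf_S2 c q2); move: (hopf c q.1) (hopf c q.2) => n n' _ hn'.
  have -> := linear_grad (fun k u v => exchange_rlinearl K k u v n').
  rewrite /dot big1 // => j _; rewrite mxE.
  suff -> : exchange K (delta_mx 0 j) n' = 0 by rewrite mul0r.
  (* By linearity in the first slot only v = e_j remains, and e_j is tangent to the sphere at e_i
     for i != j. The Hamilton equation is compared at (e_i, n') and (e_i, - n') in the direction
     (e_j, 0): the symplectic side and the magnetic term agree, the coupling changes sign. *)
  have [i ij] : exists i : 'I_3, i != j.
    by case: (eqVneq j 0) => [->|j0]; [exists 1|exists 0; rewrite eq_sym].
  have hT : T_S2xS2 (delta_mx 0 i, n') (delta_mx 0 j, 0).
    by split; apply/T_S2P; [exact: dot_delta|exact: dot0r].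
  have hT' : T_S2xS2 (delta_mx 0 i, - n') (delta_mx 0 j, 0).
    by split; apply/T_S2P; [exact: dot_delta|exact: dot0r].
  have hS : S2xS2 R (delta_mx 0 i, n') by split => //; exact: S2_delta.
  have hS' : S2xS2 R (delta_mx 0 i, - n').
    by split; [exact: S2_delta|exact: S2_opp].
  have := (ham_field_hamiltonian hS).2 _ hT.
  have := (ham_field_hamiltonian hS').2 _ hT'.
  rewrite !V_red_deriv !omega_redE XE // XE // /dV_red /= !cross0r !dot0r.
  rewrite exchange_oppr; move: (zeeman_vec _ _ _) (zeeman_vec _ _ _) (dot _ _) (exchange _ _ n') (exchange _ _ 0).
  by move=> z z' d a a' e e'; lra.
(* The Hopf map is onto, so the coupling vanishes on all pairs of unit vectors. The basis vectors
   that enter the gradients are among them, and each gradient reduces to its magnetic part. *)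
have J0 u v : S2 R u -> S2 R v -> exchange K u v = 0.
  move=> /(hopf_surj c)[U hU <-] /(hopf_surj c)[V hV <-].
  have <- := VI_hopf c (conj hU hV : Q R (U, V)).
  exact: (h (U, V) (conj hU hV)).
exists (fun n => l1^-1 *: cross n (\row_j zeeman_vec m1 b (delta_mx 0 j))).
exists (fun n => l2^-1 *: cross n (\row_j zeeman_vec m2 b (delta_mx 0 j))).
move=> n [n1 n2]; rewrite /ham_field; congr (_ *: cross _ _, _ *: cross _ _);
  apply/rowP => j; rewrite !mxE J0 ?addr0 //; exact: S2_delta.
Qed.

End Reduced.
End Dynamics.

(** * Projection of the dynamics from the tangent bundle to the spheres *)

Section ReducedDynamics.
Context {R : realType}.

(** The terms are ordered to match the pattern k A + B of [zeeman_rlinear] and the two coupling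
    lemmas, which can then rewrite repeatedly. *)
Lemma spin_line (U X : Mat R) (t : R) : spin Rgt (U + t%:C *: X) =
  t%:C *: dspin Rgt U X + ((t ^+ 2)%:C *: spin Rgt X + spin Rgt U).
Proof.
rewrite /= dagD dagZ !mulmxDl !mulmxDr -!scalemxAl -!scalemxAr scalerA.
rewrite -rmorphM -expr2 scalerDr.
move: (U *m _ *m _) (t%:C *: (U *m _ *m _)) (t%:C *: (X *m _ *m _)) => a b c.
by rewrite [a + b]addrC addrACA [b + c]addrC [a + _]addrC.
Qed.

Lemma zeeman_line m (b : 'rV[R]_3) (A B C : Mat R) (t : R) :
  zeeman m b (t%:C *: B + ((t ^+ 2)%:C *: C + A)) =
  zeeman m b A + t * zeeman m b B + t ^+ 2 * zeeman m b C.
Proof. by rewrite !zeeman_rlinear; ring. Qed.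

Lemma coupling_line K (A B C A' B' C' : Mat R) (t : R) :
  coupling K (t%:C *: B + ((t ^+ 2)%:C *: C + A))
    (t%:C *: B' + ((t ^+ 2)%:C *: C' + A')) =
  coupling K A A' + t * (coupling K B A' + coupling K A B')
  + t ^+ 2 * (coupling K B B' + coupling K A C' + coupling K C A'
              + t * (coupling K B C' + coupling K C B' + t * coupling K C C')).
Proof.
rewrite !coupling_rlinearl !coupling_rlinearr.
move: (coupling K A A') (coupling K A B') (coupling K A C') (coupling K B A')
  (coupling K B B') (coupling K B C') (coupling K C A') (coupling K C B')
  (coupling K C C') => *.
by ring.
Qed.

Lemma continuous_quad (a b c : R) :
  {for 0, continuous (fun t : R => a + t * (b + t * c) : R^o)}.
Proof.
apply: cvgD; first exact: cvg_cst.
apply: cvgM; first exact: cvg_id.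
apply: cvgD; first exact: cvg_cst.
apply: cvgM; first exact: cvg_id.
exact: cvg_cst.
Qed.

Lemma V_dird (m1 m2 : R) b K (q w : Mat R * Mat R) : Q R q -> T_Q q w ->
  exists C : R -> R^o, {for 0, continuous C} /\
  forall t : R, V Rgt m1 m2 b K (q + t%:C *: w) =
    V Rgt m1 m2 b K q + t * dV_red m1 m2 b K (hopf2 Rgt q) (dhopf2 Rgt q w)
    + t ^+ 2 * C t.
Proof.
move=> [q1 q2] [w1 w2].
have dVE : dV_red m1 m2 b K (hopf2 Rgt q) (dhopf2 Rgt q w) =
  zeeman m1 b (dspin Rgt q.1 w.1) + coupling K (dspin Rgt q.1 w.1) (spin Rgt q.2)
  + (zeeman m2 b (dspin Rgt q.2 w.2) + coupling K (spin Rgt q.1) (dspin Rgt q.2 w.2)).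
  have := spin_pauli Rgt q1; have := spin_pauli Rgt q2.
  have := dspin_pauli Rgt q1 w1; have := dspin_pauli Rgt q2 w2.
  rewrite /dV_red /zeeman_vec /exchange /hopf2 /dhopf2 /=.
  move: (hopf _ _) (hopf _ _) (dhopf _ _ _) (dhopf _ _ _) => ? ? ? ?.
  by move=> -> -> -> ->.
have VE (p : Mat R * Mat R) : V Rgt m1 m2 b K p =
  zeeman m1 b (spin Rgt p.1) + zeeman m2 b (spin Rgt p.2)
  + coupling K (spin Rgt p.1) (spin Rgt p.2) by [].
pose S1 := spin Rgt q.1; pose S2 := spin Rgt q.2.
pose D1 := dspin Rgt q.1 w.1; pose D2 := dspin Rgt q.2 w.2.
pose E1 := spin Rgt w.1; pose E2 := spin Rgt w.2.
(* The coefficients of t^2, t^3 and t^4 in the potential along the line, with t^2 factored out. *)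
exists (fun t => (zeeman m1 b E1 + zeeman m2 b E2 +
   (coupling K D1 D2 + coupling K S1 E2 + coupling K E1 S2)) +
    t * ((coupling K D1 E2 + coupling K E1 D2) + t * coupling K E1 E2)).
split; first exact: continuous_quad.
move=> t; rewrite dVE !VE.
have -> : (q + t%:C *: w).1 = q.1 + t%:C *: w.1 by [].
have -> : (q + t%:C *: w).2 = q.2 + t%:C *: w.2 by [].
rewrite !spin_line -/S1 -/S2 -/D1 -/D2 -/E1 -/E2 coupling_line !zeeman_line.
clearbody S1 S2 D1 D2 E1 E2.
move: (coupling K S1 S2) (coupling K S1 D2) (coupling K S1 E2)
  (coupling K D1 S2) (coupling K D1 D2) (coupling K D1 E2)
  (coupling K E1 S2) (coupling K E1 D2) (coupling K E1 E2)
  (zeeman m1 b S1) (zeeman m1 b D1) (zeeman m1 b E1)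
  (zeeman m2 b S2) (zeeman m2 b D2) (zeeman m2 b E2) => *.
by ring.
Qed.

Lemma energy_dird (l1 l2 m1 m2 : R) b K (x v : QQ R) : Q R x.1 -> T_Q x.1 v.1 ->
  dird (energy (lagrangian Rgt l1 l2 m1 m2 b K) : QQ R -> R^o) x v =
  - dV_red m1 m2 b K (hopf2 Rgt x.1) (dhopf2 Rgt x.1 v.1).
Proof.
move=> hx hv; have [C [Cc CE]] := V_dird m1 m2 b K hx hv.
apply: (@taylor_dird _ _ _ _ _ _ (- V Rgt m1 m2 b K x.1 : R^o) _ (fun t => - C t)).
  exact: cvgN.
move=> t; rewrite energyE.
have -> : (x + t%:C *: v).1 = x.1 + t%:C *: v.1 by [].
have -> := CE t.
move: (V _ _ _ _ _ _) (dV_red _ _ _ _ _ _) (C t) => p d e.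
by rewrite /GRing.scale /=; ring.
Qed.

Lemma char_dist_cartan1 c l m b (x : Mat R * Mat R) : l != 0 -> TSU2 R x ->
  char_dist T_TSU2 (cartan (lagrangian1 c l m b)) x = leaf_dir x.
Proof.
move=> l0 hx; rewrite -(char_dist_tau l0 hx); apply/seteqP.
split=> u [hu h]; split=> // v hv; have := h v hv; rewrite cartan1E.
  by move/eqP; rewrite oppr_eq0 => /eqP.
by move=> ->; rewrite oppr0.
Qed.

(** The Cartan form is minus the pullback of [omega] and the energy is minus the potential, so the
    signs cancel and the equation is pulled back from the spheres. Tangent vectors of TQ map onto
    those of the product of spheres, so all reduced test vectors occur, and nondegeneracy identifies
    the projected vector with the Hamiltonian field. *)
Lemma dynamics_projects (l1 l2 m1 m2 : R) b K (x u : QQ R) :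
  l1 != 0 -> l2 != 0 -> TQ R x -> T_TQ x u ->
  let LR := lagrangian Rgt l1 l2 m1 m2 b K in
  (forall v : QQ R, T_TQ x v ->
     cartan LR x u v = dird (energy LR : QQ R -> R^o) x v) <->
  dhopf2 Rgt x.1 u.1 = ham_field l1 l2 m1 m2 b K (hopf2 Rgt x.1).
Proof.
move=> l10 l20 hx hu LR.
have hq := TQ_Q hx; have hu1 := T_TQ_T_Q hu.
have [_ im _ dim] := hopf2_quotient (R := R) Rgt.
have hn : S2xS2 R (hopf2 Rgt x.1) by rewrite -im; exists x.1.
have Tn w : T_Q x.1 w -> T_S2xS2 (hopf2 Rgt x.1) (dhopf2 Rgt x.1 w).
  by move=> hw; rewrite -(dim _ hq); exists w => //; rewrite hopf2_dird.
have [hT hX] := ham_field_hamiltonian m1 m2 b K l10 l20 hn.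
have key v : T_TQ x v -> cartan LR x u v = dird (energy LR : QQ R -> R^o) x v <->
    omega_red l1 l2 (hopf2 Rgt x.1) (dhopf2 Rgt x.1 u.1) (dhopf2 Rgt x.1 v.1) =
    dV_red m1 m2 b K (hopf2 Rgt x.1) (dhopf2 Rgt x.1 v.1).
  move=> hv; have hv1 := T_TQ_T_Q hv.
  have -> : cartan LR x u v = - omega l1 l2 x.1 u.1 v.1 by exact: cartanE.
  have -> := energy_dird l1 l2 m1 m2 b K hq hv1.
  by rewrite (omega_omega_red l10 l20 hq hu1 hv1); split=> [/oppr_inj|->].
split=> [h|e v hv].
  apply: (omega_red_inj l10 l20 hn (Tn _ hu1) hT) => w.
  rewrite -(dim _ hq) => -[X hXq <-]; rewrite hopf2_dird.
  have [v hv <-] := T_TQ_lift hx hXq.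
  rewrite (proj1 (key v hv) (h v hv)) hX ?V_red_deriv //.
  exact/Tn/T_TQ_T_Q.
apply/(key v hv); rewrite e hX ?V_red_deriv //.
exact/Tn/T_TQ_T_Q.
Qed.

End ReducedDynamics.

Theorem mainTheorem4 (R : realType) (c : side) (l1 l2 m1 m2 : R)
    (b : 'rV[R]_3) (K : Mat R) (hl1 : 0 < l1) (hl2 : 0 < l2) :
  let L := lagrangian c l1 l2 m1 m2 b K in
  let w := omega l1 l2 in
  (* (1) *)
  [/\ forall x u v : QQ R, TQ R x -> T_TQ x u -> T_TQ x v ->
        cartan L x u v =
        - (tau_dalpha l1 (part1 x) (part1 u) (part1 v)
           + tau_dalpha l2 (part2 x) (part2 u) (part2 v)),
      forall x : QQ R, TQ R x ->
        char_dist T_TQ (cartan L) x =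
        [set u | char_dist T_TSU2 (tau_dalpha l1) (part1 x) (part1 u) /\
                 char_dist T_TSU2 (tau_dalpha l2) (part2 x) (part2 u)],
      forall x : QQ R, TQ R x ->
        real_iso (char_dist T_TQ (cartan L) x)
          ((u1 R `*` su2 R) `*` (u1 R `*` su2 R))
          (fun u => (ltriv (part1 x) (part1 u), ltriv (part2 x) (part2 u))) &
      isotropy_is3 R = U1 R] /\
  (* (2) *)
  [/\ closed_form2 (Q R) T_Q w,
      forall x : QQ R, TQ R x -> energy L x = - V c m1 m2 b K x.1 /\
        forall u v : QQ R, T_TQ x u -> T_TQ x v ->
          cartan L x u v = - w x.1 u.1 v.1,
      forall h q : Mat R * Mat R,
        (U1 R `*` U1 R) h -> Q R q ->
        [/\ V1 c m1 b (act c h q).1 = V1 c m1 b q.1,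
            V1 c m2 b (act c h q).2 = V1 c m2 b q.2 &
            VI c K (act c h q) = VI c K q] &
      forall q : Mat R * Mat R, Q R q -> char_dist T_Q w q = orbit_dir Rgt q] /\
  (* (3) *)
  [/\ is_quotient_manifold (Q R) T_Q (orbit_rel c) (S2xS2 R) T_S2xS2
        (hopf2 c),
      is_quotient_manifold (Q R) T_Q (orbit_rel Rgt) (S2xS2 R) T_S2xS2
        (hopf2 Rgt),
      forall q : Mat R * Mat R, Q R q ->
        V c m1 m2 b K q = V_red m1 m2 b K (hopf2 c q) &
      forall q u v : Mat R * Mat R, Q R q -> T_Q q u -> T_Q q v ->
        w q u v = omega_red l1 l2 (hopf2 Rgt q)
                    (dird (hopf2 Rgt) q u) (dird (hopf2 Rgt) q v)] /\
  (* reduced state spaces *)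
  [/\ is_quotient_manifold (TSU2 R) T_TSU2
        (leaf_rel (TSU2 R) (char_dist T_TSU2 (cartan (lagrangian1 c l1 m1 b))))
        (S2 R) T_S2 (fun x => hopf Rgt x.1),
      is_quotient_manifold (TSU2 R) T_TSU2
        (leaf_rel (TSU2 R) (char_dist T_TSU2 (cartan (lagrangian1 c l2 m2 b))))
        (S2 R) T_S2 (fun x => hopf Rgt x.1) &
      is_quotient_manifold (TQ R) T_TQ
        (leaf_rel (TQ R) (char_dist T_TQ (cartan L)))
        (S2xS2 R) T_S2xS2
        (fun x => (hopf Rgt (part1 x).1, hopf Rgt (part2 x).1))] /\
  (* reduced dynamics *)
  exists2 X : VV R -> VV R,
    hamiltonian_field (S2xS2 R) T_S2xS2 (omega_red l1 l2) (V_red m1 m2 b K) X &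
    [/\ forall X' : VV R -> VV R,
          hamiltonian_field (S2xS2 R) T_S2xS2 (omega_red l1 l2)
            (V_red m1 m2 b K) X' ->
          forall n : VV R, S2xS2 R n -> X' n = X n,
        let LR := lagrangian Rgt l1 l2 m1 m2 b K in
        forall x u : QQ R, TQ R x -> T_TQ x u ->
          ((forall v : QQ R, T_TQ x v ->
              cartan LR x u v = dird (energy LR : QQ R -> R^o) x v) <->
           dird (hopf2 Rgt) x.1 u.1 = X (hopf2 Rgt x.1)) &
        separable X <-> forall q : Mat R * Mat R, Q R q -> VI c K q = 0].
Proof.
move=> L w.
have n1 : l1 != 0 by rewrite gt_eqF.
have n2 : l2 != 0 by rewrite gt_eqF.
split; first split.
- by move=> x u v _ _ _; exact: cartanE.
- by move=> x _; exact: char_dist_cartan.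
- by move=> x hx; exact: char_dist_ltriv.
- exact: isotropy_U1.
split; first split.
- exact: omega_closed.
- by move=> x _; split; [exact: energyE|move=> u v _ _; exact: cartanE].
- move=> h q [h1 h2] _; split; rewrite /V1 /VI /act /= ?(spin_act1 c _ h1) ?(spin_act1 c _ h2) //.
- by move=> q; exact: char_dist_omega.
split; first split.
- exact: hopf2_quotient.
- exact: hopf2_quotient.
- move=> q [q1 q2].
  by rewrite V_redE /V (V1_hopf _ _ _ q1) (V1_hopf _ _ _ q2) (VI_hopf _ _ (conj q1 q2)).
- move=> q u v hq hu hv.
  by rewrite !hopf2_dird; exact: omega_omega_red.
split; first split.
- apply: is_quotient_manifold_rel TSU2_quotient => x y _ _.
  by apply: leaf_rel_eq => z hz; rewrite char_dist_cartan1.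
- apply: is_quotient_manifold_rel TSU2_quotient => x y _ _.
  by apply: leaf_rel_eq => z hz; rewrite char_dist_cartan1.
- apply: is_quotient_manifold_rel TQ_quotient => x y _ _.
  by apply: leaf_rel_eq => z hz; exact/esym/char_dist_cartan_leaf.
exists (ham_field l1 l2 m1 m2 b K); first exact: ham_field_hamiltonian.
split.
- by move=> X hX n hn; exact: ham_field_uniq hX _ hn.
- by move=> LR x u hx hu; rewrite hopf2_dird; exact: dynamics_projects.
- exact: ham_field_separable.
Qed.
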